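(* Let $d\in\{2,3\}$, let $U$ be either the cube $I^d$ or the simplex $\Delta^d$, and consider polynomial mapping functions $F:U\to\mathbb{R}^d$ of degree at most $p$ (degree at most $p$ in each individual coordinate if $U=I^d$, total degree at most $p$ if $U=\Delta^d$). The hull condition stated below, which is a sufficient condition for invertibility of $F$, has the affinity property: it is always satisfied if the mapping function $F$ is a nondegenerate affine linear mapping, or a sufficiently small perturbation of a nondegenerate affine linear mapping. Hull condition for a polynomial map $F$: if $d=2$, the matrix $[\mathbf{u},\mathbf{v}]$ with columns $\mathbf{u},\mathbf{v}$ is invertible for every $\mathbf{u}\in\operatorname{hull}(G_\xi)$ and every $\mathbf{v}\in\operatorname{hull}(G_\eta)$; if $d=3$, the matrix $[\mathbf{u},\mathbf{v},\mathbf{w}]$ with columns $\mathbf{u},\mathbf{v},\mathbf{w}$ is invertible for every $\mathbf{u}\in\operatorname{hull}(G_\xi)$, $\mathbf{v}\in\operatorname{hull}(G_\eta)$, $\mathbf{w}\in\operatorname{hull}(G_\zeta)$. Here $G_\xi,G_\eta,G_\zeta$ are the lists of Bernstein-Bézier control points of the partial derivatives of $F$ with respect to $\xi,\eta,\zeta$.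
   Context: $\operatorname{hull}$ denotes convex hull. $I^d=[0,1]^d$; $\Delta^2=\{(\xi,\eta):\xi,\eta\ge 0,\ \xi+\eta\le 1\}$; $\Delta^3=\{(\xi,\eta,\zeta):\xi,\eta,\zeta\ge 0,\ \xi+\eta+\zeta\le 1\}$. $F$ is called invertible if it is injective on $U$ and its inverse, defined on $F(U)$, is smooth. Bernstein-Bézier (BB) form: a polynomial map $F$ of degree at most $p$ is written with control points $\mathbf{f}_{i,j}\in\mathbb{R}^2$ or $\mathbf{f}_{i,j,k}\in\mathbb{R}^3$ as follows. On $I^2$: $F(\xi,\eta)=\sum_{i=0}^p\sum_{j=0}^p \mathbf{f}_{i,j}\binom{p}{i}\binom{p}{j}(1-\xi)^{p-i}\xi^i(1-\eta)^{p-j}\eta^j$. On $I^3$: $F(\xi,\eta,\zeta)=\sum_{i,j,k=0}^p \mathbf{f}_{i,j,k}\binom{p}{i}\binom{p}{j}\binom{p}{k}(1-\xi)^{p-i}\xi^i(1-\eta)^{p-j}\eta^j(1-\zeta)^{p-k}\zeta^k$. On $\Delta^2$: $F(\xi,\eta)=\sum_{i,j\ge 0,\,i+j\le p}\mathbf{f}_{i,j}\frac{p!}{i!\,j!\,(p-i-j)!}\xi^i\eta^j(1-\xi-\eta)^{p-i-j}$. On $\Delta^3$: $F(\xi,\eta,\zeta)=\sum_{i,j,k\ge 0,\,i+j+k\le p}\mathbf{f}_{i,j,k}\frac{p!}{i!\,j!\,k!\,(p-i-j-k)!}\xi^i\eta^j\zeta^k(1-\xi-\eta-\zeta)^{p-i-j-k}$.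 $G_\xi$ is the finite list of all vectors $p(\mathbf{f}_{i+1,j}-\mathbf{f}_{i,j})$ (for $d=2$) or $p(\mathbf{f}_{i+1,j,k}-\mathbf{f}_{i,j,k})$ (for $d=3$), over all indices for which both control points are defined; these are the BB control points of $\partial F/\partial\xi$. Similarly $G_\eta$ consists of all vectors $p(\mathbf{f}_{i,j+1}-\mathbf{f}_{i,j})$ or $p(\mathbf{f}_{i,j+1,k}-\mathbf{f}_{i,j,k})$, and, for $d=3$, $G_\zeta$ consists of all vectors $p(\mathbf{f}_{i,j,k+1}-\mathbf{f}_{i,j,k})$. *)

(* Defs.v *)
From HB Require Import structures.
From mathcomp Require Import all_boot all_order all_algebra.
From mathcomp Require Import all_classical all_reals all_analysis.

Set Implicit Arguments.
Unset Strict Implicit.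
Unset Printing Implicit Defensive.

Import Order.TTheory GRing.Theory Num.Theory.
Import numFieldNormedType.Exports.

Local Open Scope classical_set_scope.
Local Open Scope ring_scope.

Inductive domain := Cube | Simplex.

Definition dom (R : realType) (d : nat) (U : domain) : set 'cV[R]_d :=
  match U with
  | Cube => [set x | forall i, 0 <= x i 0 <= 1]
  | Simplex => [set x | (forall i, 0 <= x i 0) /\ \sum_i x i 0 <= 1]
  end.

(* Multi-indices (i, j) or (i, j, k) with all entries at most p. *)
Definition mindex (d p : nat) := {ffun 'I_d -> 'I_p.+1}.

Definition mweight (d p : nat) (a : mindex d p) : nat := (\sum_i a i)%N.

(* The admissible multi-indices, both for the exponents of the monomials and
   for the control points of a map of degree at most p. *)
Definition indices (d p : nat) (U : domain) : pred (mindex d p) :=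
  fun a => match U with Cube => true | Simplex => (mweight a <= p)%N end.

Definition monomial (R : realType) (d p : nat) (a : mindex d p)
    (x : 'cV[R]_d) : R :=
  \prod_i x i 0 ^+ a i.

(* Maps U -> R^d are represented by total functions of which only the values
   on U matter. *)
Definition poly_map (R : realType) (d : nat) (U : domain) (p : nat)
    (F : 'cV[R]_d -> 'cV[R]_d) : Prop :=
  exists c : mindex d p -> 'cV[R]_d, forall x, dom U x ->
    F x = \sum_(a | indices U a) monomial a x *: c a.

Definition bernstein (R : realType) (d : nat) (U : domain) (p : nat)
    (a : mindex d p) (x : 'cV[R]_d) : R :=
  match U with
  | Cube => \prod_i ('C(p, a i)%:R * (1 - x i 0) ^+ (p - a i) * x i 0 ^+ a i)
  | Simplex =>
      p`!%:R / ((\prod_i (a i)`!) * (p - mweight a)`!)%N%:R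
        * (\prod_i x i 0 ^+ a i) * (1 - \sum_i x i 0) ^+ (p - mweight a)
  end.

(* The values of f outside the admissible indices are irrelevant; the others
   are determined by F. *)
Definition control_points (R : realType) (d : nat) (U : domain) (p : nat)
    (f : mindex d p -> 'cV[R]_d) (F : 'cV[R]_d -> 'cV[R]_d) : Prop :=
  forall x, dom U x -> F x = \sum_(a | indices U a) bernstein U a x *: f a.

(* b = a + e_k *)
Definition mnext (d p : nat) (k : 'I_d) (a b : mindex d p) : bool :=
  [forall i, (b i : nat) == (a i + (i == k))%N].

(* G_xi, G_eta, G_zeta for k = 0, 1, 2. *)
Definition dcontrol (R : realType) (d : nat) (U : domain) (p : nat)
    (f : mindex d p -> 'cV[R]_d) (k : 'I_d) : seq 'cV[R]_d :=
  [seq p%:R *: (f ab.2 - f ab.1) |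
    ab in [pred ab : mindex d p * mindex d p |
            [&& indices U ab.1, indices U ab.2 & mnext k ab.1 ab.2]]].

Definition hull (R : realType) (d : nat) (s : seq 'cV[R]_d) : set 'cV[R]_d :=
  [set v | exists w : 'I_(size s) -> R,
    [/\ forall i, 0 <= w i, \sum_i w i = 1 & v = \sum_i w i *: s`_i]].

(* The matrix with columns u 0, u 1, ... *)
Definition columns (R : realType) (d : nat) (u : 'I_d -> 'cV[R]_d) : 'M[R]_d :=
  \matrix_(i, j) u j i 0.

Definition hull_condition (R : realType) (d : nat) (U : domain) (p : nat)
    (F : 'cV[R]_d -> 'cV[R]_d) : Prop :=
  exists2 f : mindex d p -> 'cV[R]_d, control_points U f F &
    forall u : 'I_d -> 'cV[R]_d,
      (forall k, hull (dcontrol U f k) (u k)) -> columns u \in unitmx.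

(* C^k on an open set O: directional derivatives are used in place of partial
   derivatives. *)
Fixpoint Ck (R : realType) (m n k : nat) (O : set 'cV[R]_m)
    (g : 'cV[R]_m -> 'cV[R]_n) : Prop :=
  match k with
  | 0%N => forall x, O x -> {for x, continuous g}
  | k'.+1 => (forall x, O x -> differentiable g x) /\
             (forall v, Ck k' O (fun x => 'D_v g x))
  end.

(* Smoothness on a set that need not be open, such as F(U): locally the
   function extends to a C^oo function on an open set. *)
Definition smooth_on (R : realType) (m n : nat) (S : set 'cV[R]_m)
    (g : 'cV[R]_m -> 'cV[R]_n) : Prop :=
  forall y, S y -> exists (O : set 'cV[R]_m) (h : 'cV[R]_m -> 'cV[R]_n),
    [/\ open O, O y, forall k, Ck k O h & forall z, S z -> O z -> h z = g z].

Definition invertible_on (R : realType) (d : nat) (U : set 'cV[R]_d)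
    (F : 'cV[R]_d -> 'cV[R]_d) : Prop :=
  set_inj U F /\
  exists2 G : 'cV[R]_d -> 'cV[R]_d,
    (forall x, U x -> G (F x) = x) & smooth_on (F @` U) G.

Definition nondegenerate_affine (R : realType) (d : nat) (U : set 'cV[R]_d)
    (F : 'cV[R]_d -> 'cV[R]_d) : Prop :=
  exists (A : 'M[R]_d) (b : 'cV[R]_d),
    A \in unitmx /\ forall x, U x -> F x = A *m x + b.

(* Perturbations range over the maps of degree at most p, a finite-dimensional
   space on which all norms are equivalent; the sup norm over U is used. *)
Definition affinity_property (R : realType) (d : nat) (U : domain) (p : nat)
    (C : ('cV[R]_d -> 'cV[R]_d) -> Prop) : Prop :=
  (forall F, poly_map U p F -> nondegenerate_affine (dom U) F -> C F) /\
  (forall L, nondegenerate_affine (dom U) L ->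
    exists2 eps : R, 0 < eps &
      forall F, poly_map U p F ->
        (forall x, dom U x -> `|F x - L x| < eps) -> C F).

(* Main.v *)
Require Import Defs.
From HB Require Import structures.
From mathcomp Require Import all_boot all_order all_algebra.
From mathcomp Require Import all_classical all_reals all_analysis.
From mathcomp Require Import ring lra.

(* A map in Bernstein-Bezier form is evaluated by de Casteljau's algorithm: it is
   the expectation of the control point reached by a random walk on the
   multi-indices whose step probabilities are the coordinates of x. Replacing the
   parameter x by y one step at a time gives F y - F x = M(x, y) (y - x), where
   the columns of M(x, y) are averages over the control points of the partial
   derivatives. For x, y in U these columns lie in the hulls, so the hull
   condition makes M(x, y) invertible and F injective. As M is polynomial, a
   contraction argument inverts F near each point of U, the inverse h satisfies
   h z - h w = M(h w, h z)^-1 (z - w), and hence its derivatives are polynomials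
   in h and 1 / det M(h, h); compactness of U identifies h with the global
   inverse on F(U).

   For the affinity property, the control net of x |-> A x + b consists of the
   values of this map at the points a / p, so all vectors in the k-th list are
   equal to the k-th column of A; interpolation on a finite grid shows that a
   small perturbation of the map has a control net close to this one. *)

Set Implicit Arguments.
Unset Strict Implicit.
Unset Printing Implicit Defensive.

Import Order.TTheory GRing.Theory Num.Theory.
Import numFieldNormedType.Exports.

Local Open Scope classical_set_scope.
Local Open Scope ring_scope.

(** * De Casteljau's algorithm as a random walk *)

Section Operators.
Variables (R : realType) (d : nat).
Implicit Types (x y v : 'cV[R]_d) (S : {set 'I_d}) (L : seq {set 'I_d}).

(** Entries are unbounded, so that a step of the walk is always defined; [of_mindex] and [to_mindex]
    relate them to the bounded indices of control points. *)
Definition midx := {ffun 'I_d -> nat}.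
Implicit Types (a b c : midx) (g h : midx -> 'cV[R]_d).

Definition midx0 : midx := [ffun=> 0%N].
Definition inc (k : 'I_d) c : midx := [ffun i => (c i + (i == k))%N].
Definition dec (k : 'I_d) c : midx := [ffun i => (c i - (i == k))%N].

Lemma incK k : cancel (inc k) (dec k).
Proof. by move=> c; apply/ffunP => i; rewrite !ffunE addnK. Qed.

Lemma decK k c : (0 < c k)%N -> inc k (dec k c) = c.
Proof.
move=> ck; apply/ffunP => i; rewrite !ffunE subnK//.
by case: eqVneq => // ->.
Qed.

Lemma incC k l c : inc k (inc l c) = inc l (inc k c).
Proof. by apply/ffunP => i; rewrite !ffunE addnAC. Qed.

(* The expectation of g after one step of the walk from c, which goes to c + e_k
   with probability x_k for k in S, and stays at c otherwise. *)
Definition step S x g c :=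
  g c + \sum_(k in S) x k 0 *: (g (inc k c) - g c).

(** The walk starts at 0. Since [step T] acts on [g] first, the head of the list is the last step of
    the walk. *)
Fixpoint expect L x g :=
  if L is T :: L' then expect L' x (step T x g) else g midx0.

(** One summand for each step that may go in direction [k]: there a forward difference is taken, the
    steps before it in the list use [y] and those after it use [x]. *)
Fixpoint slope L x y (k : 'I_d) g : 'cV[R]_d :=
  if L is T :: L' then
    slope L' x y k (step T y g) +
    (k \in T)%:R *: expect L' x (fun c => g (inc k c) - g c)
  else 0.

Lemma eq_expect L x g h : g =1 h -> expect L x g = expect L x h.
Proof. by move=> /funext ->. Qed.

Lemma expectP L x t g h :
  expect L x (fun c => t *: g c + h c) = t *: expect L x g + expect L x h.
Proof.
elim: L g h => [//|S L IH] g h /=.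
rewrite -IH; apply: eq_expect => c; rewrite /step scalerDr scaler_sumr addrACA.
congr (_ + _); rewrite -big_split; apply: eq_bigr => k _ /=.
by rewrite opprD addrACA -scalerBr scalerDr !scalerA mulrC.
Qed.

Lemma expect0 L x : expect L x (fun=> 0) = 0.
Proof.
elim: L => [//|S L IH] /=; rewrite -[RHS]IH; apply: eq_expect => c.
by rewrite /step big1 ?addr0// => k _; rewrite subrr scaler0.
Qed.

Lemma expectD L x g h :
  expect L x (fun c => g c + h c) = expect L x g + expect L x h.
Proof.
rewrite -[expect L x g]scale1r -expectP; apply: eq_expect => c.
by rewrite scale1r.
Qed.

Lemma expectZ L x t g : expect L x (fun c => t *: g c) = t *: expect L x g.
Proof.
rewrite -[RHS]addr0 -(expect0 L x) -expectP; apply: eq_expect => c.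
by rewrite addr0.
Qed.

Lemma expect_sum L x (I : Type) (r : seq I) (P : pred I) (F : I -> midx -> _) :
  expect L x (fun c => \sum_(i <- r | P i) F i c) =
  \sum_(i <- r | P i) expect L x (F i).
Proof.
elim: r => [|i r IH].
  rewrite big_nil -[RHS](expect0 L x); apply: eq_expect => c.
  by rewrite big_nil.
rewrite big_cons -IH; case: ifP => Pi; last first.
  by apply: eq_expect => c; rewrite big_cons Pi.
by rewrite -expectD; apply: eq_expect => c; rewrite big_cons Pi.
Qed.

(** Telescoping: the steps are switched from [x] to [y] one at a time, and the two versions of a
    single step differ by the coordinates of [y - x] times forward differences of [g]. *)
Lemma expect_slope L x y g :
  expect L y g - expect L x g =
  \sum_k (y k 0 - x k 0) *: slope L x y k g.
Proof.
elim: L g => [|S L IH] g /=.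
  by rewrite subrr big1// => k _; rewrite scaler0.
rewrite -(subrKA (expect L x (step S y g))) IH.
have -> : expect L x (step S y g) - expect L x (step S x g) =
    \sum_k (y k 0 - x k 0) *:
      ((k \in S)%:R *: expect L x (fun c => g (inc k c) - g c)).
  rewrite -scaleN1r addrC -expectP.
  rewrite (@eq_expect L x _ (fun c => \sum_k ((y k 0 - x k 0) * (k \in S)%:R) *:
     (g (inc k c) - g c))); last first.
    move=> c; rewrite /step scaleN1r opprD addrACA addNr add0r -sumrN -big_split.
    rewrite [LHS]big_mkcond; apply: eq_bigr => k _ /=; case: (k \in S) => /=.
      by rewrite mulr1 scalerBl addrC.
    by rewrite mulr0 scale0r.
  by rewrite expect_sum; apply: eq_bigr => k _; rewrite expectZ scalerA.
rewrite -big_split; apply: eq_bigr => k _ /=.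
by rewrite scalerDr.
Qed.

(* Combinations of total weight m; m = 1 gives hull. *)
Definition whull (m : R) (s : seq 'cV[R]_d) : set 'cV[R]_d :=
  [set v | exists w : 'I_(size s) -> R,
    [/\ forall i, 0 <= w i, \sum_i w i = m & v = \sum_i w i *: s`_i]].

Lemma whull0 s : whull 0 s 0.
Proof.
exists (fun=> 0); split => //; first by rewrite big1.
by rewrite big1// => i _; rewrite scale0r.
Qed.

Lemma whullD m n s u v : whull m s u -> whull n s v -> whull (m + n) s (u + v).
Proof.
move=> [w [w0 <- ->]] [w' [w'0 <- ->]]; exists (fun i => w i + w' i); split.
- by move=> i; rewrite addr_ge0.
- by rewrite big_split.
- by rewrite -big_split; apply: eq_bigr => i _; rewrite scalerDl.
Qed.

Lemma whullZ m s t v : 0 <= t -> whull m s v -> whull (t * m) s (t *: v).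
Proof.
move=> t0 [w [w0 <- ->]]; exists (fun i => t * w i); split.
- by move=> i; rewrite mulr_ge0.
- by rewrite mulr_sumr.
- by rewrite scaler_sumr; apply: eq_bigr => i _; rewrite scalerA.
Qed.

Lemma whull_mem s v : v \in s -> whull 1 s v.
Proof.
move=> /(nthP 0)[n ns <-]; exists (fun i => (i == Ordinal ns)%:R); split.
- by move=> i; rewrite ler0n.
- rewrite (bigD1 (Ordinal ns))//= eqxx big1 ?addr0// => i /negbTE ->//.
- rewrite (bigD1 (Ordinal ns))//= eqxx scale1r big1 ?addr0// => i /negbTE ->.
  by rewrite scale0r.
Qed.

(** This is a convex combination: [V k] has weight [x k 0], and [v] has the remaining weight, which
    is nonnegative. *)
Lemma whull_step m s S x v (V : 'I_d -> 'cV[R]_d) :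
    (forall k, 0 <= x k 0) -> \sum_(k in S) x k 0 <= 1 ->
    whull m s v -> (forall k, k \in S -> whull m s (V k)) ->
  whull m s (v + \sum_(k in S) x k 0 *: (V k - v)).
Proof.
move=> x0 x1 hv hV.
have -> : v + \sum_(k in S) x k 0 *: (V k - v) =
    (1 - \sum_(k in S) x k 0) *: v + \sum_(k in S) x k 0 *: V k.
  rewrite scalerBl scale1r scaler_suml -addrA; congr (_ + _).
  rewrite -sumrN -big_split; apply: eq_bigr => k _ /=.
  by rewrite scalerBr addrC.
have -> : m = (1 - \sum_(k in S) x k 0) * m + \sum_(k in S) x k 0 * m.
  by rewrite -mulr_suml -mulrDl subrK mul1r.
apply: whullD; first by apply: whullZ => //; rewrite subr_ge0.
elim/big_rec2: _ => [|k u n kS IH]; first exact: whull0.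
by apply: whullD => //; apply: whullZ => //; exact: hV.
Qed.

(** The possible end points of the walk; a step may also stay put, whence the first disjunct. *)
Fixpoint reach L c : bool :=
  if L is T :: L' then
    reach L' c || [exists k in T, (0 < c k)%N && reach L' (dec k c)]
  else c == midx0.

Lemma reach_cons S L c : reach L c -> reach (S :: L) c.
Proof. by move=> /= ->. Qed.

Lemma reach_inc S L k c : k \in S -> reach L c -> reach (S :: L) (inc k c).
Proof.
move=> kS Lc /=; apply/orP; right; apply/existsP; exists k.
by rewrite kS incK Lc ffunE eqxx addn1.
Qed.

Definition walkable L x :=
  (forall k, 0 <= x k 0) /\ (forall S, S \in L -> \sum_(k in S) x k 0 <= 1).

Lemma walkable_cons S L x : walkable (S :: L) x ->
  [/\ forall k, 0 <= x k 0, \sum_(k in S) x k 0 <= 1 & walkable L x].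
Proof.
move=> [x0 x1]; split => //; first by apply: x1; rewrite mem_head.
by split => // T TL; apply: x1; rewrite in_cons TL orbT.
Qed.

Lemma expect_whull L x m s g : walkable L x ->
  (forall c, reach L c -> whull m s (g c)) -> whull m s (expect L x g).
Proof.
elim: L g => [|S L IH] g /=; first by move=> _; apply.
move=> /walkable_cons[x0 xS xL] H; apply: IH => // c Lc.
apply: whull_step => //; first by apply: H; rewrite Lc.
by move=> k kS; apply: H; exact: (reach_inc kS Lc).
Qed.

Definition occ (k : 'I_d) L := count (fun T : {set 'I_d} => k \in T) L.

(** Each step that involves [k] contributes an average of forward differences, of weight [m]. The
    induction goes through because differences commute with [step]: those of [step S y g] are
    averages of those of [g]. *)
Lemma slope_whull L x y m s k g : walkable L x -> walkable L y ->
    (forall c, reach L c -> reach L (inc k c) ->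
      whull m s (g (inc k c) - g c)) ->
  whull ((occ k L)%:R * m) s (slope L x y k g).
Proof.
elim: L g => [|S L IH] g; first by rewrite mul0r => *; exact: whull0.
move=> /walkable_cons[x0 xS xL] /walkable_cons[y0 yS yL] H.
rewrite /= addnC natrD mulrDl; apply: whullD.
  apply: IH => // c Lc Lkc; rewrite /step.
  have -> : g (inc k c) + \sum_(l in S) y l 0 *: (g (inc l (inc k c)) -
      g (inc k c)) - (g c + \sum_(l in S) y l 0 *: (g (inc l c) - g c)) =
    (g (inc k c) - g c) + \sum_(l in S) y l 0 *:
      ((g (inc k (inc l c)) - g (inc l c)) - (g (inc k c) - g c)).
    rewrite opprD addrACA; congr (_ + _).
    rewrite -sumrN -big_split; apply: eq_bigr => l _ /=.
    rewrite -scalerBr incC; congr (_ *: _).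
    by rewrite !opprD !opprK addrACA.
  apply: whull_step => //; first by apply: H; exact: reach_cons.
  by move=> l lS; apply: H; rewrite 1?incC; exact: reach_inc.
case kS: (k \in S); last by rewrite mul0r scale0r; exact: whull0.
rewrite mul1r scale1r; apply: expect_whull => // c Lc.
by apply: H; [exact: reach_cons|exact: reach_inc].
Qed.

(* The Newton basis, dual to iterated forward differences at 0; it is turned
   into the monomial basis by expect. *)
Definition newton a c : nat := \prod_i 'C(c i, a i).

(** The number of walks from 0 to [a], which is the constant relating the Newton basis to the
    monomials. *)
Fixpoint walks L a : nat :=
  if L is T :: L' then
    (walks L' a + \sum_(k in T | (0 < a k)%N) walks L' (dec k a))%N
  else (a == midx0).

Definition mono a x : R := \prod_i x i 0 ^+ a i.

Lemma mono0 x : mono midx0 x = 1.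
Proof. by rewrite /mono big1// => i _; rewrite ffunE expr0. Qed.

Lemma mono_dec k a x : (0 < a k)%N -> x k 0 * mono (dec k a) x = mono a x.
Proof.
move=> ak; rewrite /mono (bigD1 k)//= [in RHS](bigD1 k)//= !ffunE eqxx mulrA.
rewrite -exprS subn1 prednK//; congr (_ * _); apply: eq_bigr => i /negbTE ik.
by rewrite ffunE ik subn0.
Qed.

Lemma newton0 a : newton a midx0 = (a == midx0).
Proof.
rewrite /newton; case: eqVneq => [->|a0].
  by rewrite big1// => i _; rewrite ffunE.
have [i ai] : exists i, a i != 0%N.
  apply/existsP; apply: contraR a0; rewrite negb_exists => /forallP H.
  by apply/eqP/ffunP => i; rewrite ffunE; apply/eqP/negPn/H.
by rewrite (bigD1 i)//= ffunE bin0n (negbTE ai).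
Qed.

(** Pascal's rule in the [k]-th factor. *)
Lemma newton_inc k a c : newton a (inc k c) =
  (newton a c + (if (0 < a k)%N then newton (dec k a) c else 0))%N.
Proof.
rewrite /newton (bigD1 k)//= [in RHS](bigD1 k)//= ffunE eqxx addn1.
under eq_bigr => i /negbTE ik do rewrite ffunE ik addn0.
case ak: (a k) => [|n] /=; first by rewrite !bin0 addn0.
rewrite binS mulnDl; congr (_ + _)%N.
rewrite [in RHS](bigD1 k)//= ffunE eqxx ak subn1; congr (_ * _)%N.
by apply: eq_bigr => i /negbTE ik; rewrite ffunE ik subn0.
Qed.

Lemma step_newton S x a v c :
  step S x (fun c => (newton a c)%:R *: v) c =
  (newton a c)%:R *: v +
  \sum_(k in S | (0 < a k)%N) (newton (dec k a) c)%:R *: (x k 0 *: v).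
Proof.
rewrite /step; congr (_ + _); rewrite [in RHS]big_mkcondr; apply: eq_bigr => k kS.
rewrite -scalerBl newton_inc natrD addrAC subrr add0r.
by case: ifP => _; rewrite ?scale0r ?scaler0// !scalerA mulrC.
Qed.

(** By Pascal's rule a step adds to [newton a] the terms [x k 0] times [newton (dec k a)]. At 0 only
    the index 0 survives, so each walk to [a] contributes one monomial. *)
Lemma expect_newton L x a v :
  expect L x (fun c => (newton a c)%:R *: v) = ((walks L a)%:R * mono a x) *: v.
Proof.
elim: L a v => [|S L IH] a v /=.
  rewrite newton0; case: eqVneq => [->|_]; first by rewrite mono0 mulr1.
  by rewrite mul0r.
rewrite (eq_expect _ _ (step_newton S x a v)) expectD IH expect_sum.
rewrite natrD mulrDl scalerDl; congr (_ + _).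
rewrite natr_sum mulr_suml scaler_suml; apply: eq_bigr => k /andP[_ ak].
by rewrite IH -(mono_dec x ak) scalerA -mulrA [x k 0 * _]mulrC.
Qed.

Lemma walks_gt0 L a : reach L a -> (0 < walks L a)%N.
Proof.
elim: L a => [|S L IH] a /=; first by move=> ->.
case/orP => [/IH H|/existsP[k /and3P[kS ak /IH H]]]; first by rewrite addn_gt0 H.
by rewrite addn_gt0 (bigD1 k) ?kS//= addn_gt0 H orbT.
Qed.

(* The probability that the walk from 0 ends at c. *)
Fixpoint beta L x c : R :=
  if L is T :: L' then
    (1 - \sum_(k in T) x k 0) * beta L' x c +
    \sum_(k in T | (0 < c k)%N) x k 0 * beta L' x (dec k c)
  else (c == midx0)%:R.

Lemma reach_occ L c k : reach L c -> (c k <= occ k L)%N.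
Proof.
elim: L c => [|S L IH] c /=; first by move=> /eqP ->; rewrite ffunE.
case/orP => [/IH H|/existsP[l /and3P[lS cl /IH]]].
  exact: (leq_trans H (leq_addl _ _)).
rewrite ffunE leq_subLR => /leq_trans; apply; rewrite leq_add2r.
by case: eqVneq => // ->; rewrite lS.
Qed.

Lemma beta_reach L x c : beta L x c != 0 -> reach L c.
Proof.
elim: L c => [|S L IH] c /=.
  by case: (c == midx0) => //; rewrite eqxx.
apply: contraNT; rewrite negb_or => /andP[Lc /existsPn Hk].
have -> : beta L x c = 0 by apply/eqP; apply: contraNT Lc => /IH.
rewrite mulr0 add0r big1// => k /andP[kS ck].
have := Hk k; rewrite kS ck /= => Lk.
have -> : beta L x (dec k c) = 0 by apply/eqP; apply: contraNT Lk => /IH.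
by rewrite mulr0.
Qed.

Section Bounded.
Variable p : nat.

Definition of_mindex (a : mindex d p) : midx := [ffun i => a i : nat].

Lemma of_mindex_inj : injective of_mindex.
Proof.
move=> a b /ffunP E; apply/ffunP => i; apply/val_inj.
by have := E i; rewrite !ffunE.
Qed.

Definition to_mindex c : mindex d p := [ffun i => inord (c i)].

Lemma to_mindexK c : (forall i, (c i <= p)%N) -> of_mindex (to_mindex c) = c.
Proof. by move=> cp; apply/ffunP => i; rewrite !ffunE inordK ?ltnS ?cp. Qed.

Lemma of_mindexK : cancel of_mindex to_mindex.
Proof. by move=> a; apply/ffunP => i; rewrite !ffunE inord_val. Qed.

(** A shift of the summation index; the hypothesis on [B] discards the indices whose [k]-th entry is
    [p], as their shift would leave the range. *)
Lemma sum_inc k (B : midx -> R) g :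
    (forall c, B c != 0 -> (c k < p)%N) ->
  \sum_(a : mindex d p) B (of_mindex a) *: g (inc k (of_mindex a)) =
  \sum_(a : mindex d p | (0 < of_mindex a k)%N)
     B (dec k (of_mindex a)) *: g (of_mindex a).
Proof.
move=> Bp.
rewrite (bigID (fun a : mindex d p => (a k < p)%N)) /= [X in _ + X]big1; last first.
  move=> a; rewrite -leqNgt => pk; rewrite (_ : B _ = 0) ?scale0r//.
  by apply/eqP; apply: contraLR pk => /Bp; rewrite ffunE -ltnNge.
rewrite addr0.
rewrite (reindex_onto (fun a : mindex d p => to_mindex (dec k (of_mindex a)))
                      (fun a : mindex d p => to_mindex (inc k (of_mindex a)))) /=; last first.
  move=> a ak; rewrite to_mindexK ?incK ?of_mindexK// => i; rewrite !ffunE.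
  by case: eqVneq => [->|_]; rewrite ?addn1// addn0 -ltnS.
have tdK (a : mindex d p) : of_mindex (to_mindex (dec k (of_mindex a))) = dec k (of_mindex a).
  by apply: to_mindexK => i; rewrite !ffunE (leq_trans (leq_subr _ _))// -ltnS.
rewrite (eq_bigl (fun a : mindex d p => (0 < of_mindex a k)%N)) => [|a].
  by apply: eq_bigr => a a0; rewrite tdK decK.
apply/andP/idP => [[ap /eqP E]|a0].
  rewrite -E [of_mindex _ k]ffunE [to_mindex _ k]ffunE.
  by rewrite [inc _ _ _]ffunE eqxx addn1 [of_mindex _ _]ffunE inordK.
rewrite tdK.
rewrite decK// of_mindexK eqxx; split=> //.
rewrite ffunE !ffunE eqxx subn1 inordK.
  by move: a0; rewrite ffunE => a0; rewrite -ltnS prednK.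
by rewrite (leq_ltn_trans (leq_pred _)).
Qed.

(** The recursion of [beta] is adjoint to [step]: [sum_inc] moves the shift from [g] to [beta]. The
    bound on [occ] keeps all end points in the range. *)
Lemma expect_beta L x g : (forall k, (occ k L <= p)%N) ->
  expect L x g =
  \sum_(a : mindex d p) beta L x (of_mindex a) *: g (of_mindex a).
Proof.
elim: L g => [|S L IH] g Lp /=.
  have E : of_mindex (to_mindex midx0) = midx0.
    by apply: to_mindexK => i; rewrite ffunE.
  rewrite (bigD1 (to_mindex midx0))//= E eqxx scale1r big1 ?addr0// => a a0.
  rewrite -E (inj_eq of_mindex_inj) (negbTE a0) scale0r//.
have Lp' k : (occ k L <= p)%N by apply: leq_trans (Lp k); rewrite leq_addl.
rewrite IH//.
have -> : \sum_(a : mindex d p) beta L x (of_mindex a) *: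
      step S x g (of_mindex a) =
    (1 - \sum_(k in S) x k 0) *:
      \sum_(a : mindex d p) beta L x (of_mindex a) *: g (of_mindex a) +
    \sum_(k in S) x k 0 *:
      \sum_(a : mindex d p) beta L x (of_mindex a) *: g (inc k (of_mindex a)).
  rewrite scalerBl scale1r scaler_suml -addrA -sumrN -big_split /=.
  under [X in _ = _ + X]eq_bigr => k _.
    rewrite -scaleNr !scaler_sumr -big_split; under eq_bigr do
      rewrite /= scaleNr addrC !scalerA ![x k 0 * _]mulrC -!scalerA -!scalerBr.
    over.
  rewrite /= exchange_big -big_split; apply: eq_bigr => a _ /=.
  rewrite /step scalerDr scaler_sumr; congr (_ + _).
under [X in _ + X = _]eq_bigr => k kS.
  rewrite sum_inc; last first.
    move=> c /beta_reach/reach_occ => /(_ k) H; apply: (leq_ltn_trans H).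
    by apply: leq_trans (Lp k); rewrite /= kS.
  over.
rewrite scaler_sumr.
under [X in _ = X]eq_bigr do rewrite scalerDl.
rewrite big_split /=; congr (_ + _).
  by apply: eq_bigr => a _; rewrite scalerA.
under [X in _ = X]eq_bigr do rewrite scaler_suml.
rewrite (exchange_big_dep (fun k => k \in S))/=; last by move=> a k _ /andP[].
apply: eq_bigr => k kS; rewrite scaler_sumr.
rewrite [RHS](eq_bigl (fun a : mindex d p => (0 < of_mindex a k)%N)); last first.
  by move=> a; rewrite kS.
by apply: eq_bigr => a _; rewrite scalerA.
Qed.

End Bounded.

End Operators.

(** * The Bernstein basis *)

Section Bernstein.
Variables (R : realType) (d : nat).
Implicit Types (x y : 'cV[R]_d) (c : midx d) (l : seq 'I_d).

Definition weight c := (\sum_i c i)%N.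

Lemma weight_dec k c : (0 < c k)%N -> weight c = (weight (dec k c)).+1.
Proof.
move=> ck; rewrite /weight (bigD1 k)//= [in RHS](bigD1 k)//= ffunE eqxx subn1.
rewrite -addSn prednK//; congr (_ + _)%N.
by apply: eq_bigr => i /negbTE ik; rewrite ffunE ik subn0.
Qed.

Lemma weight_eq0 c : (weight c == 0)%N = (c == midx0 d).
Proof.
apply/eqP/eqP => [w0|->]; last by rewrite /weight big1// => i _; rewrite ffunE.
apply/ffunP => i; rewrite ffunE; apply/eqP.
by rewrite -leqn0 -w0 /weight (bigD1 i)//= leq_addr.
Qed.

Lemma reach_simplex n c : reach (nseq n [set: 'I_d]%SET) c = (weight c <= n)%N.
Proof.
elim: n c => [|n IH] c /=; first by rewrite leqn0 weight_eq0.
rewrite IH; apply/orP/idP => [[/leqW//|/existsP[k /and3P[_ ck]]]|].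
  by rewrite IH (weight_dec ck).
rewrite leq_eqVlt ltnS => /orP[/eqP wc|]; last by left.
right; have : weight c != 0%N by rewrite wc.
rewrite weight_eq0; apply: contraR => /existsPn H.
apply/eqP/ffunP => k; rewrite ffunE; have := H k.
case: posnP => // ck; rewrite inE/= IH -ltnS -weight_dec// wc.
by rewrite leqnn.
Qed.

Definition factorials c := (\prod_i (c i)`!)%N.

Lemma factorials_dec k c :
  (0 < c k)%N -> factorials c = (c k * factorials (dec k c))%N.
Proof.
move=> ck; rewrite /factorials (bigD1 k)//= [in RHS](bigD1 k)//= ffunE eqxx subn1.
rewrite mulnA -{1}(prednK ck) factS prednK//; congr (_ * _)%N.
by apply: eq_bigr => i /negbTE ik; rewrite ffunE ik subn0.
Qed.

Lemma factorials_gt0 c : (0 < factorials c)%N.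
Proof. by rewrite prodn_gt0// => i; rewrite fact_gt0. Qed.

(** The two parts of the recursion are the claimed value times [(n.+1 - weight c) / n.+1] and
    [weight c / n.+1], and these factors add up to 1. *)
Lemma beta_simplex n x c : (weight c <= n)%N ->
  beta (nseq n [set: 'I_d]%SET) x c =
  n`!%:R / (factorials c * (n - weight c)`!)%N%:R * mono c x *
    (1 - \sum_i x i 0) ^+ (n - weight c).
Proof.
elim: n c => [|n IH] c wc.
  move: wc; rewrite leqn0 weight_eq0 => /eqP -> /=; rewrite eqxx mono0.
  have -> : factorials (midx0 d) = 1%N.
    by apply: big1 => i _; rewrite ffunE.
  by rewrite sub0n expr0 mul1n fact0 divr1 !mulr1.
set T := RHS.
have nne0 : n.+1%:R != 0 :> R by rewrite pnatr_eq0.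
have sumT : \sum_(k in [set: 'I_d]%SET) x k 0 = \sum_k x k 0.
  by apply: eq_bigl => k; rewrite inE.
have first_term : (1 - \sum_(k in [set: 'I_d]%SET) x k 0) * beta (nseq n [set: 'I_d]%SET) x c =
    T * (n.+1 - weight c)%N%:R / n.+1%:R.
  (* If [weight c = n.+1], then [c] is out of reach in [n] steps and both sides vanish. *)
  move: wc; rewrite leq_eqVlt ltnS => /orP[/eqP wc|wc].
    have -> : beta (nseq n [set: 'I_d]%SET) x c = 0.
      apply/eqP; apply/negPn/negP => /beta_reach.
      by rewrite reach_simplex wc ltnn.
    by rewrite wc subnn mulr0 mulr0 mul0r.
  rewrite IH// sumT /T subSn// !factS exprS.
  rewrite !natrM; field.
  by rewrite !nat1r !pnatr_eq0 -!lt0n factorials_gt0 fact_gt0.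
have next_term k : (0 < c k)%N -> x k 0 * beta (nseq n [set: 'I_d]%SET) x (dec k c) =
    T * (c k)%:R / n.+1%:R.
  move=> ck; have wk := weight_dec ck.
  rewrite IH; last by rewrite -ltnS -wk.
  rewrite /T -(mono_dec x ck) wk subSS (factorials_dec ck) factS.
  have c0 : (c k)%:R != 0 :> R by rewrite pnatr_eq0 -lt0n.
  rewrite !natrM; field.
  by rewrite c0 !nat1r !pnatr_eq0 -!lt0n factorials_gt0 fact_gt0.
rewrite /= first_term.
have -> : \sum_(k in [set: 'I_d]%SET | (0 < c k)%N)
   x k 0 * beta (nseq n [set: 'I_d]%SET) x (dec k c) = T * (weight c)%:R / n.+1%:R.
  rewrite /weight natr_sum -mulrA mulr_suml mulr_sumr [LHS]big_mkcond.
  apply: eq_bigr => k _; rewrite inE/=; case: posnP => [->|ck].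
    by rewrite mul0r mulr0.
  by rewrite next_term// mulrA.
by rewrite -mulrDl -mulrDr -natrD subnK// mulfK.
Qed.

Definition singles l : seq {set 'I_d} := [seq [set i]%SET | i <- l].

Lemma occ_singles k l : occ k (singles l) = count_mem k l.
Proof.
rewrite /occ count_map; apply: eq_count => i /=.
by rewrite inE eq_sym.
Qed.

Lemma reach_singles l c : reach (singles l) c = [forall i, c i <= count_mem i l]%N.
Proof.
elim: l c => [|k l IH] c /=.
  apply/eqP/forallP => [-> i|H]; first by rewrite ffunE.
  by apply/ffunP => i; rewrite ffunE; apply/eqP; rewrite -leqn0; exact: H.
apply/orP/forallP => [[|/existsP[j /and3P[]]] | H].
- rewrite IH => /forallP H i; exact: leq_trans (H i) (leq_addl _ _).
- rewrite inE => /eqP -> ck; rewrite IH => /forallP H i.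
  by have := H i; rewrite ffunE leq_subLR eq_sym.
have [ck|ck] := posnP (c k).
  left; rewrite IH; apply/forallP => i; have := H i.
  by case: eqVneq => // <- _; rewrite ck.
right; apply/existsP; exists k; rewrite inE eqxx ck IH /=.
by apply/forallP => i; rewrite ffunE leq_subLR eq_sym; exact: H.
Qed.

Definition bern (n m : nat) (t : R) : R :=
  'C(n, m)%:R * (1 - t) ^+ (n - m) * t ^+ m.

Lemma bernS n m t : bern n.+1 m t =
  (1 - t) * bern n m t + (if (0 < m)%N then t * bern n m.-1 t else 0).
Proof.
rewrite /bern; case: m => [|m] /=.
  by rewrite !bin0 !subn0 addr0 !mul1r mulr1 exprS mulr1.
rewrite binS natrD subSS [t ^+ m.+1]exprS.
have [mn|nm] := ltnP m n.
  by rewrite -(subnSK mn) exprS; ring.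
have -> : 'C(n, m.+1) = 0%N by rewrite bin_small ?ltnS.
by ring.
Qed.

(** A step in the single direction [k] changes only the [k]-th factor, by the recursion [bernS]. *)
Lemma beta_singles l x c :
  beta (singles l) x c = \prod_i bern (count_mem i l) (c i) (x i 0).
Proof.
elim: l c => [|k l IH] c /=.
  case: eqVneq => [->|c0].
    by rewrite big1// => i _; rewrite ffunE /bern bin0 !expr0 !mulr1.
  have [i ci] : exists i, c i != 0%N.
    apply/existsP; apply: contraR c0; rewrite negb_exists => /forallP H.
    by apply/eqP/ffunP => i; rewrite ffunE; apply/eqP/negPn/H.
  by rewrite (bigD1 i)//= /bern bin0n (negbTE ci) !mul0r.
rewrite !IH big_set1 (bigD1 k)//= [in RHS](bigD1 k)//= eqxx add1n bernS.
rewrite [RHS]mulrDl [X in X + _ = _]mulrA.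
have E (a b : 'I_d -> nat) : (forall i, i != k -> a i = b i) ->
  \prod_(i | i != k) bern (count_mem i l) (a i) (x i 0) =
  \prod_(i | i != k) bern ((k == i) + count_mem i l) (b i) (x i 0).
  by move=> ab; apply: eq_bigr => i ik; rewrite eq_sym (negbTE ik) ab.
rewrite (E c c)//; congr (_ + _).
case: posnP => [c0|ck].
  rewrite mul0r big1// => i /andP[]; rewrite inE => /eqP ->.
  by rewrite c0.
rewrite (big_pred1 k) => [|i]; last first.
  by rewrite inE /=; case: eqVneq => // ->.
rewrite IH (bigD1 k)//= ffunE eqxx subn1 mulrA; congr (_ * _).
by apply: E => i /negbTE ik; rewrite ffunE ik subn0.
Qed.

(** Chosen so that the end point has the Bernstein polynomials as its distribution: [p] separate
    steps in each direction for the tensor product basis, [p] steps with free choice of direction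
    for total degree [p]. *)
Definition steps (U : domain) (p : nat) : seq {set 'I_d} :=
  match U with
  | Cube => singles (flatten [seq nseq p i | i <- enum 'I_d])
  | Simplex => nseq p [set: 'I_d]%SET
  end.

Lemma count_flatten_nseq p k :
  count_mem k (flatten [seq nseq p i | i <- enum 'I_d]) = p.
Proof.
have H s : uniq s -> count_mem k (flatten [seq nseq p i | i <- s]) = ((k \in s) * p)%N.
  elim: s => [//|i s IH] /= /andP[is0 us].
  rewrite count_cat count_nseq IH// in_cons -mulnDl /= eq_sym.
  by case: eqVneq => // ->; rewrite (negbTE is0).
by rewrite H ?enum_uniq// mem_enum mul1n.
Qed.

Variables (U : domain) (p : nat).

Lemma occ_steps k : occ k (steps U p) = p.
Proof.
case: U => /=; first by rewrite occ_singles count_flatten_nseq.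
by rewrite /occ count_nseq inE mul1n.
Qed.

Lemma reach_steps (a : mindex d p) :
  reach (steps U p) (of_mindex a) = indices U a.
Proof.
case: U => /=.
  rewrite reach_singles; apply/forallP => i.
  by rewrite count_flatten_nseq ffunE -ltnS.
rewrite reach_simplex; congr (_ <= _)%N.
by apply: eq_bigr => i _; rewrite ffunE.
Qed.

Lemma mono_of_mindex (a : mindex d p) x : mono (of_mindex a) x = monomial a x.
Proof. by apply: eq_bigr => i _; rewrite ffunE. Qed.

Lemma beta_steps (a : mindex d p) x : indices U a ->
  beta (steps U p) x (of_mindex a) = bernstein U a x.
Proof.
rewrite -reach_steps; case: U => /= H.
  rewrite beta_singles; apply: eq_bigr => i _.
  by rewrite count_flatten_nseq ffunE.
move: H; rewrite reach_simplex => H; rewrite beta_simplex//.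
rewrite mono_of_mindex /mweight.
have -> : weight (of_mindex a) = (\sum_i a i)%N.
  by apply: eq_bigr => i _; rewrite ffunE.
have -> // : factorials (of_mindex a) = (\prod_i (a i)`!)%N.
by apply: eq_bigr => i _; rewrite ffunE.
Qed.

Lemma walkable_steps x : dom U x -> walkable (steps U p) x.
Proof.
case: U => [H|[H0 H1]]; split => //.
- by move=> k; have /andP[] := H k.
- move=> S /mapP[i _ ->]; rewrite big_set1.
  by have /andP[] := H i.
- move=> S /nseqP[-> _]; apply: le_trans H1.
  by rewrite (eq_bigl xpredT)// => i; rewrite inE.
Qed.

Lemma bernstein_sum (f : midx d -> 'cV[R]_d) x :
  \sum_(a : mindex d p | indices U a) bernstein U a x *: f (of_mindex a) =
  expect (steps U p) x f.
Proof.
rewrite (expect_beta (p := p)); last by move=> k; rewrite occ_steps.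
rewrite [LHS]big_mkcond; apply: eq_bigr => a _; case: ifPn => [/beta_steps->//|].
rewrite -reach_steps => /negP H.
have -> : beta (steps U p) x (of_mindex a) = 0; last by rewrite scale0r.
by apply/eqP/negPn/negP => /beta_reach.
Qed.

End Bernstein.

(** * Control nets and hulls *)

Lemma mxnorm_le (R : realType) m n (A : 'M[R]_(m, n)) (e : R) :
  0 <= e -> (forall i j, `|A i j| <= e) -> `|A| <= e.
Proof.
move=> e0 H; rewrite /Num.Def.normr/= mx_normrE.
by apply: bigmax_le => // -[i j] _; exact: H.
Qed.

Lemma ler_mxnorm (R : realType) m n (A : 'M[R]_(m, n)) i j : `|A i j| <= `|A|.
Proof.
rewrite [leRHS]/Num.Def.normr/= mx_normrE.
exact: (le_bigmax _ (fun ij : 'I_m * 'I_n => `|A ij.1 ij.2|) (i, j)).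
Qed.

Lemma mxnormM (R : realType) m n q (A : 'M[R]_(m, n)) (B : 'M[R]_(n, q)) :
  `|A *m B| <= n%:R * `|A| * `|B|.
Proof.
apply: mxnorm_le => [|i j]; first by rewrite !mulr_ge0.
rewrite mxE; apply: (le_trans (ler_norm_sum _ _ _)).
rewrite -mulrA mulr_natl -[X in _ <= _ *+ X]card_ord -sumr_const.
by apply: ler_sum => k _; rewrite normrM ler_pM// ler_mxnorm.
Qed.

Lemma unitmx_ker (F : fieldType) n (B : 'M[F]_n) :
  (forall v : 'cV[F]_n, B *m v = 0 -> v = 0) -> B \in unitmx.
Proof.
move=> H; rewrite -unitmx_tr -row_free_unit -kermx_eq0.
apply/eqP/row_matrixP => i; rewrite row0; apply/trmx_inj.
rewrite trmx0; apply: H; rewrite -[X in X *m _]trmxK -trmx_mul.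
by rewrite -row_mul mulmx_ker row0 trmx0.
Qed.

(** A kernel vector [v] satisfies [- v = (B - 1%:M) *m v], which is strictly shorter than [v] unless
    [v = 0]. The factor [n] appears because the norm is the largest absolute entry. *)
Lemma unitmx_near1 (R : realType) n (B : 'M[R]_n) :
  n%:R * `|B - 1%:M| < 1 -> B \in unitmx.
Proof.
move=> B1; apply: unitmx_ker => v Bv; apply/eqP; rewrite -normr_eq0.
apply: contraTT B1; rewrite -normr_gt0 normr_id -leNgt => v0.
rewrite -(ler_pM2r v0) mul1r -[X in X <= _]normrN.
have -> : - v = (B - 1%:M) *m v by rewrite mulmxBl Bv mul1mx sub0r.
exact: mxnormM.
Qed.

Section ControlNet.
Variables (R : realType) (d : nat) (U : domain) (p : nat).
Implicit Types (x y : 'cV[R]_d) (f : mindex d p -> 'cV[R]_d).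

(** Values at indices out of range are arbitrary; the walk never reaches them. *)
Definition net f : midx d -> 'cV[R]_d := f \o @to_mindex d p.

Definition bezier f x := expect (steps d U p) x (net f).

Lemma control_bezier f (F : 'cV[R]_d -> 'cV[R]_d) :
  control_points U f F <-> forall x, dom U x -> F x = bezier f x.
Proof.
suff E x : \sum_(a | indices U a) bernstein U a x *: f a = bezier f x.
  by split => H x Ux; rewrite H.
rewrite /bezier -bernstein_sum; apply: eq_bigr => a _.
by rewrite /net /= of_mindexK.
Qed.

(** A matrix of divided differences; on the diagonal [x = y] it is the Jacobian matrix. *)
Definition slope_mx f x y : 'M[R]_d :=
  columns (fun k => slope (steps d U p) x y k (net f)).

Lemma bezierB f x y : bezier f y - bezier f x = slope_mx f x y *m (y - x).
Proof.
rewrite /bezier expect_slope; apply/colP => i; rewrite summxE mxE.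
by apply: eq_bigr => k _; rewrite !mxE mulrC.
Qed.

Lemma reach_steps_le c (i : 'I_d) : reach (steps d U p) c -> (c i <= p)%N.
Proof. by move=> /reach_occ => /(_ i); rewrite occ_steps. Qed.

(** Exactly [p] steps involve [k], and a difference of neighbouring control points is [p%:R^-1]
    times a member of the list, so the total weight is 1. *)
Lemma slope_hull f k x y : (0 < p)%N -> dom U x -> dom U y ->
  hull (dcontrol U f k) (slope (steps d U p) x y k (net f)).
Proof.
move=> p0 Ux Uy; have pn0 : p%:R != 0 :> R by rewrite pnatr_eq0 -lt0n.
suff : whull (p%:R * p%:R^-1) (dcontrol U f k)
   (slope (steps d U p) x y k (net f)) by rewrite divff.
rewrite -{1}(occ_steps U p k); apply: slope_whull.
- exact: walkable_steps.
- exact: walkable_steps.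
move=> c cL ckL; rewrite -[p%:R^-1]mulr1.
rewrite -[_ - _](scalerK pn0); apply: whullZ; first by rewrite invr_ge0.
apply: whull_mem; rewrite /dcontrol; apply/fintype.imageP.
have cE : of_mindex (to_mindex p c) = c.
  by apply: to_mindexK => i; exact: reach_steps_le cL.
have ckE : of_mindex (to_mindex p (inc k c)) = inc k c.
  by apply: to_mindexK => i; exact: reach_steps_le ckL.
exists (to_mindex p c, to_mindex p (inc k c)) => //.
rewrite inE /= -!reach_steps cE ckE cL ckL /=.
apply/forallP => i; rewrite -[X in _ == (X + _)%N](ffunE (fun i => to_mindex p c i : nat)).
rewrite -/(of_mindex _) cE -[X in X == _](ffunE (fun i => to_mindex p (inc k c) i : nat)).
by rewrite -/(of_mindex _) ckE ffunE.
Qed.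

Lemma dcontrolP f k v : v \in dcontrol U f k ->
  exists a b : mindex d p, of_mindex b = inc k (of_mindex a) /\
    v = p%:R *: (f b - f a).
Proof.
rewrite /dcontrol => /fintype.imageP[[a b]] /=; rewrite inE /= => /and3P[_ _ /forallP ab] ->.
exists a, b; split => //; apply/ffunP => i; rewrite !ffunE.
by apply/eqP; exact: ab.
Qed.

End ControlNet.

(** * Control nets of affine maps and their stability *)

Section Affine.
Variables (R : realType) (d : nat) (U : domain).
Implicit Types (x : 'cV[R]_d) (A : 'M[R]_d) (b : 'cV[R]_d).

Lemma expect_affine L x (g : midx d -> 'cV[R]_d) (w : 'I_d -> 'cV[R]_d) :
    (forall k c, g (inc k c) - g c = w k) ->
  expect L x g = g (midx0 d) + \sum_k ((occ k L)%:R * x k 0) *: w k.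
Proof.
elim: L g => [|S L IH] g gw /=.
  by rewrite big1 ?addr0// => k _; rewrite mul0r scale0r.
have sE c : step S x g c = g c + \sum_(k in S) x k 0 *: w k.
  by congr (_ + _); apply: eq_bigr => k _; rewrite gw.
rewrite IH => [|k c]; last by rewrite !sE opprD addrACA subrr addr0 gw.
rewrite sE -addrA; congr (_ + _); rewrite [X in X + _]big_mkcond -big_split /=.
apply: eq_bigr => k _; rewrite natrD mulrDl scalerDl.
by case: (k \in S); rewrite ?mul1r// mul0r scale0r.
Qed.

Definition affine_net p A b (c : midx d) : 'cV[R]_d :=
  A *m (p%:R^-1 *: \col_i (c i)%:R) + b.

Lemma affine_net_inc p A b k c :
  affine_net p A b (inc k c) - affine_net p A b c = p%:R^-1 *: col k A.
Proof.
rewrite /affine_net opprD addrACA subrr addr0 -mulmxBr -scalerBr -scalemxAr.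
congr (_ *: _); rewrite colE; congr (_ *m _); apply/colP => i.
by rewrite !mxE ffunE natrD addrAC subrr add0r eqxx andbT.
Qed.

Lemma expect_affine_net p A b x : (0 < p)%N ->
  expect (steps d U p) x (affine_net p A b) = A *m x + b.
Proof.
move=> p0; rewrite (expect_affine _ _ (affine_net_inc p A b)).
have -> : affine_net p A b (midx0 d) = b.
  rewrite /affine_net (_ : \col_i _ = 0) ?scaler0 ?mulmx0 ?add0r//.
  by apply/colP => i; rewrite !mxE ffunE.
rewrite addrC; congr (_ + _).
under eq_bigr => k _ do rewrite occ_steps scalerA mulrAC divff ?mul1r ?pnatr_eq0 -?lt0n//.
apply/colP => i; rewrite summxE mxE; apply: eq_bigr => k _.
by rewrite !mxE mulrC.
Qed.

Lemma unitmx_near A : A \in unitmx -> exists2 e : R, 0 < e &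
  forall B : 'M[R]_d, (forall i j, `|B i j - A i j| <= e) -> B \in unitmx.
Proof.
move=> Au; pose K := d%:R * (d%:R * `|invmx A|).
have K0 : 0 <= K by rewrite !mulr_ge0.
(* Then [d%:R * |invmx A *m B - 1|] is at most [K / (K + 1) < 1], as [unitmx_near1] requires. *)
exists (K + 1)^-1; first by rewrite invr_gt0 ltr_wpDl.
move=> B BA; have e0 : 0 <= (K + 1)^-1 by rewrite invr_ge0 addr_ge0.
have : invmx A *m B \in unitmx.
  apply: unitmx_near1.
  rewrite -(mulVmx Au) -mulmxBr.
  apply: (@le_lt_trans _ _ (K * `|B - A|)).
    by rewrite /K -[leRHS]mulrA ler_wpM2l// mxnormM.
  apply: (@le_lt_trans _ _ (K / (K + 1))).
    by rewrite ler_wpM2l//; apply: mxnorm_le => // i j; rewrite !mxE.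
  by rewrite ltr_pdivrMr ?mul1r ?ltrDl// ltr_wpDl.
by rewrite unitmx_mul => /andP[].
Qed.

Lemma hull_close s (v0 v : 'cV[R]_d) (e : R) :
  (forall u, u \in s -> `|u - v0| <= e) -> hull s v -> `|v - v0| <= e.
Proof.
move=> H [w [w0 w1 ->]].
have -> : \sum_i w i *: s`_i - v0 = \sum_i w i *: (s`_i - v0).
  under [RHS]eq_bigr do rewrite scalerBr.
  by rewrite sumrB -scaler_suml w1 scale1r.
rewrite (le_trans (ler_norm_sum _ _ _))//.
rewrite -[leRHS]mul1r -w1 mulr_suml; apply: ler_sum => i _.
by rewrite normrZ (ger0_norm (w0 i)) ler_wpM2l// H// mem_nth.
Qed.

Lemma hull_unitmx_near p A b : (0 < p)%N -> A \in unitmx ->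
  exists2 e : R, 0 < e & forall f : mindex d p -> 'cV[R]_d,
    (forall a, `|f a - affine_net p A b (of_mindex a)| <= e) ->
    forall u : 'I_d -> 'cV[R]_d,
      (forall k, hull (dcontrol U f k) (u k)) -> columns u \in unitmx.
Proof.
move=> p0 /unitmx_near[e e0 He].
have pn0 : 0 < p%:R :> R by rewrite ltr0n.
(* The factor 2 pays for the two control points in a difference, the factor [p] for the scaling in
   [dcontrol]. *)
exists (e / (p%:R * 2)); first by rewrite divr_gt0// mulr_gt0.
move=> f fA u uh; apply: He => i j.
have := ler_mxnorm (u j - col j A) i 0; rewrite !mxE => /le_trans; apply.
apply: hull_close (uh j) => v /dcontrolP[a1 [a2 [a12 ->]]].
have -> : p%:R *: (f a2 - f a1) - col j A =
    p%:R *: ((f a2 - affine_net p A b (of_mindex a2)) -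
             (f a1 - affine_net p A b (of_mindex a1))).
  rewrite -{1}(scalerKV (lt0r_neq0 pn0) (col j A)).
  rewrite -(affine_net_inc p A b j (of_mindex a1)) -a12 -scalerBr.
  by congr (_ *: _); rewrite !opprD !opprK addrACA.
rewrite normrZ gtr0_norm//.
apply: le_trans (_ : p%:R * (e / (p%:R * 2) + e / (p%:R * 2)) <= _).
  by rewrite ler_pM2l// (le_trans (ler_normB _ _))// lerD.
by rewrite le_eqVlt; apply/orP; left; apply/eqP; field; rewrite lt0r_neq0.
Qed.

End Affine.

(** * Interpolation and the affinity property *)

Section Interpolation.
Variables (R : realType) (d : nat) (U : domain) (p : nat).
Implicit Types (x v : 'cV[R]_d) (a b q : mindex d p).

(** Conversion from monomial coefficients to control points, obtained by reading [expect_newton]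
    backwards. *)
Lemma monomial_control (c : mindex d p -> 'cV[R]_d) x :
  \sum_(a | indices U a) monomial a x *: c a =
  expect (steps d U p) x (fun t => \sum_(a | indices U a)
    (newton (of_mindex a) t)%:R *:
      ((walks (steps d U p) (of_mindex a))%:R^-1 *: c a)).
Proof.
rewrite expect_sum; apply: eq_bigr => a aU.
rewrite expect_newton scalerA mono_of_mindex mulrAC divff ?mul1r//.
by rewrite pnatr_eq0 -lt0n walks_gt0// reach_steps.
Qed.

(* d.+1 in the denominator places the interpolation grid inside the simplex. *)
Definition node (j : 'I_p.+1) : R := j%:R / (p.+1 * d.+1)%N%:R.

Definition grid q : 'cV[R]_d := \col_i node (q i).

Lemma node_ge0 j : 0 <= node j.
Proof. by rewrite divr_ge0. Qed.

Lemma node_le j : node j <= d.+1%:R^-1.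
Proof.
rewrite /node natrM invfM mulrA ler_piMl ?invr_ge0//.
by rewrite ler_pdivrMr ?ltr0n// mul1r ler_nat ltnW.
Qed.

Lemma node_inj : injective node.
Proof.
move=> i j /(mulIf _) H; apply/val_inj/eqP.
by rewrite -(eqr_nat R) H// invr_eq0 pnatr_eq0.
Qed.

Lemma grid_dom q : dom U (grid q).
Proof.
case: U => /= [i|].
  rewrite mxE node_ge0 (le_trans (node_le _))//.
  by rewrite invf_le1 ?ltr0n// ler1n.
split=> [i|]; first by rewrite mxE node_ge0.
apply: (@le_trans _ _ (\sum_(i < d) d.+1%:R^-1)).
  by apply: ler_sum => i _; rewrite mxE node_le.
rewrite sumr_const card_ord -[_ *+ d]mulr_natl ler_pdivrMr ?ltr0n//.
by rewrite mul1r ler_nat.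
Qed.

(** Row [i] holds the weights that recover the [i]-th coefficient of a polynomial in one variable
    from its values at the nodes. *)
Definition inv_vandermonde : 'M[R]_p.+1 :=
  invmx (Vandermonde p.+1 (\row_j node j))^T.

Lemma inv_vandermondeE i j :
  \sum_k inv_vandermonde i k * node k ^+ (j : 'I_p.+1) = (i == j)%:R.
Proof.
have /mulVmx/matrixP/(_ i j) : (Vandermonde p.+1 (\row_j node j))^T \in unitmx.
  rewrite unitmx_tr unitmxE det_Vandermonde unitfE.
  apply/prodf_neq0 => k _; apply/prodf_neq0 => l kl; rewrite !mxE subr_eq0.
  by apply: contraTneq kl => /node_inj ->; rewrite ltnn.
rewrite !mxE => <-; apply: eq_bigr => k _.
by rewrite !mxE.
Qed.

(** The weights on the grid are products of one-variable weights; after exchanging the sums, the sum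
    over [q] factors into one Kronecker delta per coordinate. *)
Lemma coef_interpolation (c : mindex d p -> 'cV[R]_d) a : indices U a ->
  c a = \sum_(q : mindex d p) (\prod_i inv_vandermonde (a i) (q i)) *:
    \sum_(b | indices U b) monomial b (grid q) *: c b.
Proof.
move=> aU; under eq_bigr do rewrite scaler_sumr.
rewrite exchange_big /=.
have E b : \sum_(q : mindex d p) (\prod_i inv_vandermonde (a i) (q i)) *: (monomial b (grid q) *: c b)
    = (a == b)%:R *: c b.
  under eq_bigr do rewrite scalerA /monomial -big_split /=.
  rewrite -scaler_suml; congr (_ *: _).
  have -> : \sum_(q : mindex d p) \prod_i (inv_vandermonde (a i) (q i) * grid q i 0 ^+ b i) =
     \sum_(q : mindex d p) \prod_i (inv_vandermonde (a i) (q i) * node (q i) ^+ b i).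
    by apply: eq_bigr => q _; apply: eq_bigr => i _; rewrite mxE.
  rewrite -(bigA_distr_bigA (fun i j => inv_vandermonde (a i) j * node j ^+ b i)).
  under eq_bigr do rewrite inv_vandermondeE.
  have [->|ab] := eqVneq a b; first by rewrite big1// => i _; rewrite eqxx.
  have [i ai] : exists i, a i != b i.
    apply/existsP; apply: contraR ab; rewrite negb_exists => /forallP H.
    by apply/eqP/ffunP => i; apply/eqP/negPn/H.
  by rewrite (bigD1 i)//= (negbTE ai) mul0r.
under eq_bigr do rewrite E.
rewrite (bigD1 a)//= eqxx scale1r big1 ?addr0// => b /andP[_].
by rewrite eq_sym => /negbTE ->; rewrite scale0r.
Qed.

Lemma small_control : exists2 K : R, 0 < K &
  forall (F : 'cV[R]_d -> 'cV[R]_d) e, poly_map U p F -> 0 <= e ->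
    (forall x, dom U x -> `|F x| <= e) ->
    exists2 f : mindex d p -> 'cV[R]_d, control_points U f F &
      forall a, `|f a| <= K * e.
Proof.
(* [C] bounds a coefficient by the values on the grid; [W] and [N] are the factors in the passage
   from coefficients to control points. *)
pose W a : R := (walks (steps d U p) (of_mindex a))%:R^-1.
pose C a : R := \sum_(q : mindex d p) `|\prod_i inv_vandermonde (a i) (q i)|.
pose N b a : R := (newton (of_mindex a) (of_mindex b))%:R.
have C0 a : 0 <= C a by apply: sumr_ge0.
have W0 a : 0 <= W a by rewrite invr_ge0.
pose K := \sum_b \sum_(a | indices U a) N b a * (W a * C a).
have K0 b : 0 <= \sum_(a | indices U a) N b a * (W a * C a).
  by apply: sumr_ge0 => a _; rewrite !mulr_ge0.
exists (K + 1); first by rewrite ltr_wpDl// sumr_ge0.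
move=> F e [c Fc] e0 Fe.
have ce a : indices U a -> `|c a| <= C a * e.
  move=> aU; rewrite (coef_interpolation _ aU).
  rewrite (le_trans (ler_norm_sum _ _ _))// mulr_suml; apply: ler_sum => q _.
  rewrite normrZ ler_wpM2l// -Fc; last exact: grid_dom.
  by apply: Fe; exact: grid_dom.
exists (fun b => \sum_(a | indices U a) N b a *: (W a *: c a)).
  move=> x Ux; rewrite Fc// monomial_control -bernstein_sum.
  by apply: eq_bigr.
move=> b; rewrite (le_trans (ler_norm_sum _ _ _))//.
apply: (@le_trans _ _ ((\sum_(a | indices U a) N b a * (W a * C a)) * e)).
  rewrite mulr_suml; apply: ler_sum => a aU.
  rewrite !normrZ -!mulrA !ger0_norm// ler_wpM2l// ler_wpM2l//.
  exact: ce.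
rewrite ler_wpM2r// ler_wpDr// /K [leRHS](bigD1 b)//= lerDl.
by apply: sumr_ge0.
Qed.

Lemma poly_mapD (F G : 'cV[R]_d -> 'cV[R]_d) :
  poly_map U p F -> poly_map U p G -> poly_map U p (fun x => F x + G x).
Proof.
move=> [c Fc] [c' Gc]; exists (fun a => c a + c' a) => x Ux.
rewrite Fc// Gc// -big_split; apply: eq_bigr => a _.
by rewrite scalerDr.
Qed.

Lemma poly_mapN (F : 'cV[R]_d -> 'cV[R]_d) :
  poly_map U p F -> poly_map U p (fun x => - F x).
Proof.
move=> [c Fc]; exists (fun a => - c a) => x Ux.
rewrite Fc// -sumrN; apply: eq_bigr => a _.
by rewrite scalerN.
Qed.

Lemma poly_map_mono c v : reach (steps d U p) c ->
  poly_map U p (fun x : 'cV[R]_d => mono c x *: v).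
Proof.
move=> cL; have cE : of_mindex (to_mindex p c) = c.
  by apply: to_mindexK => i; exact: reach_steps_le cL.
exists (fun a => (a == to_mindex p c)%:R *: v) => x _.
rewrite (bigD1 (to_mindex p c)) -?reach_steps ?cE//= eqxx scale1r.
rewrite -mono_of_mindex cE big1 ?addr0// => a /andP[_ /negbTE ->].
by rewrite scale0r scaler0.
Qed.

Lemma poly_map_affine (A : 'M[R]_d) v : (0 < p)%N ->
  poly_map U p (fun x => A *m x + v).
Proof.
move=> p0.
have r0 L : reach L (midx0 d) by elim: L => //= S L ->.
(* The coordinate functions have admissible exponents: as [p] is positive, some step involves
   [k]. *)
have r1 k : reach (steps d U p) (inc k (midx0 d)).
  have : (0 < occ k (steps d U p))%N by rewrite occ_steps.
  rewrite /occ -has_count => /hasP[S + kS].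
  elim: (steps d U p) => // T L IH; rewrite in_cons => /orP[/eqP <-|/IH H].
    exact: reach_inc.
  exact: reach_cons.
have sum s : poly_map U p (fun x => \sum_(k <- s) mono (inc k (midx0 d)) x *: col k A).
  elim: s => [|k s IH].
    by exists (fun=> 0) => x _; rewrite big_nil big1// => a _; rewrite scaler0.
  have [c H] := poly_mapD (poly_map_mono (col k A) (r1 k)) IH.
  by exists c => x Ux; rewrite big_cons H.
have [c H] := poly_mapD (sum (index_enum 'I_d)) (poly_map_mono v (r0 _)).
exists c => x Ux; rewrite -H// mono0 scale1r; congr (_ + _).
apply/colP => i; rewrite summxE mxE; apply: eq_bigr => k _.
rewrite -(@mono_dec _ _ k) ?incK ?mono0 ?mulr1; last by rewrite ffunE eqxx addn1.
by rewrite !mxE mulrC.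
Qed.

End Interpolation.

(** For degree bound 0 no two indices are neighbours, so the lists are empty, and so are their
    hulls: no empty family of weights has sum 1. *)
Lemma hull_condition_deg0 (R : realType) (d : nat) (U : domain)
    (F : 'cV[R]_d -> 'cV[R]_d) : (0 < d)%N ->
  poly_map U 0 F -> hull_condition U 0 F.
Proof.
move=> d0 [c Fc].
exists (fun b => \sum_(a | indices U a) (newton (of_mindex a) (of_mindex b))%:R *:
    ((walks (steps d U 0) (of_mindex a))%:R^-1 *: c a)).
  by move=> x Ux; rewrite Fc// monomial_control -bernstein_sum; apply: eq_bigr.
move=> u /(_ (Ordinal d0)).
set s := dcontrol _ _ _; case: (posnP (size s)) => [s0 [w [_ /eqP + _]]|].
  rewrite big1 ?(eq_sym 0) ?oner_eq0// => i.
  by have /= := ltn_ord i; move: (nat_of_ord i) => n; rewrite s0.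
case sE: s => [//|v s'] _ _; have : v \in s by rewrite sE mem_head.
move=> /dcontrolP[a [b [/ffunP/(_ (Ordinal d0)) + _]]].
by rewrite !ffunE eqxx (ord1 (b _)) addn1.
Qed.

Lemma hull_condition_affinity (R : realType) (d : nat) (U : domain) (p : nat) :
  (0 < d)%N -> affinity_property U p (@hull_condition R d U p).
Proof.
move=> d0.
have pert (L : 'cV[R]_d -> 'cV[R]_d) : nondegenerate_affine (dom U) L ->
    exists2 eps : R, 0 < eps &
      forall F, poly_map U p F ->
        (forall x, dom U x -> `|F x - L x| < eps) -> hull_condition U p F.
  move=> [A [v [Au LA]]]; case: (posnP p) => [->|p0].
    by exists 1 => // F Fp _; exact: hull_condition_deg0.
  have [e e0 He] := hull_unitmx_near U v p0 Au.
  have [K K0 HK] := small_control R d U p.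
  exists (e / K); first by rewrite divr_gt0.
  move=> F Fp FL.
  have [|||f fF fe] := HK (fun x => F x + - (A *m x + v)) (e / K).
  - by apply: poly_mapD => //; apply: poly_mapN; exact: poly_map_affine.
  - by rewrite divr_ge0// ltW.
  - by move=> x Ux; rewrite -LA// ltW// FL.
  (* The control net of the affine map plus that of the difference; by the choice of [e / K] the
     latter is bounded by [e]. *)
  exists (fun a => affine_net p A v (of_mindex a) + f a).
    move=> x Ux; under eq_bigr do rewrite scalerDr.
    rewrite big_split /= -(fF x Ux) (@bernstein_sum _ _ U p (affine_net p A v)).
    by rewrite expect_affine_net// addrC subrK.
  apply: He => a; rewrite addrAC subrr add0r.
  by rewrite (le_trans (fe a))// mulrC divfK ?lt0r_neq0.
(* An affine [F] is a perturbation of itself at distance 0. *)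
split=> // F Fp /pert[eps eps0]; apply => // x _.
by rewrite subrr normr0.
Qed.

(** * Algebras of functions and differentiability *)

Section GeneratedAlgebra.
Variables (T : Type) (K : comNzRingType).
Implicit Types (f : T -> K).

(** As an inductive predicate it reduces continuity, differentiability and closure under derivatives
    to the generators. *)
Inductive algebra_of (gen : set (T -> K)) : set (T -> K) :=
| algebra_of_gen f : gen f -> algebra_of gen f
| algebra_of_cst a : algebra_of gen (fun=> a)
| algebra_ofD f g : algebra_of gen f -> algebra_of gen g ->
    algebra_of gen (fun t => f t + g t)
| algebra_ofM f g : algebra_of gen f -> algebra_of gen g ->
    algebra_of gen (fun t => f t * g t).

Variable gen : set (T -> K).
Local Notation alg := (algebra_of gen).

Lemma algebra_of_sum (I : Type) (r : seq I) (P : pred I) (F : I -> T -> K) :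
  (forall i, alg (F i)) -> alg (fun t => \sum_(i <- r | P i) F i t).
Proof.
move=> H; elim: r => [|i r IH].
  by under eq_fun do rewrite big_nil; exact: algebra_of_cst.
under eq_fun do rewrite big_cons; case: (P i) => //.
exact: algebra_ofD.
Qed.

Lemma algebra_of_prod (I : Type) (r : seq I) (P : pred I) (F : I -> T -> K) :
  (forall i, alg (F i)) -> alg (fun t => \prod_(i <- r | P i) F i t).
Proof.
move=> H; elim: r => [|i r IH].
  by under eq_fun do rewrite big_nil; exact: algebra_of_cst.
under eq_fun do rewrite big_cons; case: (P i) => //.
exact: algebra_ofM.
Qed.

Lemma algebra_of_det n (M : T -> 'M[K]_n) :
  (forall i j, alg (fun t => M t i j)) -> alg (fun t => \det (M t)).
Proof.
move=> H; apply: algebra_of_sum => s.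
by apply: algebra_ofM; [exact: algebra_of_cst|exact: algebra_of_prod].
Qed.

Lemma algebra_of_adj n (M : T -> 'M[K]_n) i j :
  (forall i j, alg (fun t => M t i j)) -> alg (fun t => (\adj (M t)) i j).
Proof.
move=> H; under eq_fun do rewrite mxE /cofactor.
apply: algebra_ofM; first exact: algebra_of_cst.
by apply: algebra_of_det => k l; under eq_fun do rewrite !mxE; exact: H.
Qed.

End GeneratedAlgebra.

(** * Polynomial dependence of the slope matrix on its arguments *)

Section SlopeAlgebra.
Variables (R : realType) (d : nat) (T : Type) (gen : set (T -> R)).
Local Notation alg := (algebra_of gen).
Implicit Types (x y : T -> 'cV[R]_d) (g : T -> midx d -> 'cV[R]_d).

Let alg_diff g k : (forall c i, alg (fun t => g t c i 0)) ->
  forall c i, alg (fun t => (g t (inc k c) - g t c) i 0).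
Proof.
move=> H c i.
have -> : (fun t => (g t (inc k c) - g t c) i 0) =
    (fun t => g t (inc k c) i 0 + (-1) * g t c i 0).
  by apply/funext => t; rewrite !mxE mulN1r.
by apply: algebra_ofD => //; apply: algebra_ofM => //; exact: algebra_of_cst.
Qed.

Let alg_step S x g : (forall k, alg (fun t => x t k 0)) ->
  (forall c i, alg (fun t => g t c i 0)) ->
  forall c i, alg (fun t => step S (x t) (g t) c i 0).
Proof.
move=> Hx H c i.
have -> : (fun t => step S (x t) (g t) c i 0) =
    (fun t => g t c i 0 + \sum_(k in S) x t k 0 * (g t (inc k c) - g t c) i 0).
  apply/funext => t; rewrite mxE summxE; congr (_ + _).
  by apply: eq_bigr => k _; rewrite [LHS]mxE.
apply: algebra_ofD => //; apply: algebra_of_sum => k.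
by apply: algebra_ofM => //; exact: alg_diff.
Qed.

Lemma algebra_of_expect L x g : (forall k, alg (fun t => x t k 0)) ->
  (forall c i, alg (fun t => g t c i 0)) ->
  forall i, alg (fun t => expect L (x t) (g t) i 0).
Proof.
move=> Hx; elim: L g => [|S L IH] g H i /=; first exact: H.
by apply: (IH (fun t => step S (x t) (g t))); exact: alg_step.
Qed.

Lemma algebra_of_slope L x y k g : (forall k, alg (fun t => x t k 0)) ->
  (forall k, alg (fun t => y t k 0)) ->
  (forall c i, alg (fun t => g t c i 0)) ->
  forall i, alg (fun t => slope L (x t) (y t) k (g t) i 0).
Proof.
move=> Hx Hy; elim: L g => [|S L IH] g H i /=.
  by under eq_fun do rewrite mxE; exact: algebra_of_cst.
under eq_fun do rewrite mxE [X in _ + X]mxE.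
apply: algebra_ofD.
  by apply: (IH (fun t => step S (y t) (g t))); exact: alg_step.
apply: algebra_ofM; first exact: algebra_of_cst.
by apply: (algebra_of_expect _ (g := fun t c => g t (inc k c) - g t c)) => //; exact: alg_diff.
Qed.

Lemma algebra_of_slope_mx U p (f : mindex d p -> 'cV[R]_d) x y :
  (forall k, alg (fun t => x t k 0)) -> (forall k, alg (fun t => y t k 0)) ->
  forall i j, alg (fun t => slope_mx U f (x t) (y t) i j).
Proof.
move=> Hx Hy i j; under eq_fun do rewrite mxE.
apply: (algebra_of_slope _ _ (g := fun=> net f)) => // c k.
exact: algebra_of_cst.
Qed.

End SlopeAlgebra.

Lemma algebra_of_continuous (R : realType) (T : topologicalType)
    (gen : set (T -> R)) t :
  (forall f, gen f -> {for t, continuous f}) ->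
  forall f, algebra_of gen f -> {for t, continuous f}.
Proof.
move=> H f; elim=> {f} [f /H//|a|f g _ cf _ cg|f g _ cf _ cg].
- exact: cst_continuous.
- exact: continuousD.
- exact: continuousM.
Qed.

Lemma near_dist_le (R : realType) (V : normedModType R) (v : V) (e : R) :
  0 < e -> \forall w \near v, `|v - w| <= e.
Proof. by move=> e0; apply/nbhs_normP; exists e => //= w /ltW. Qed.

(** * Criteria for differentiability *)

Section Differentiability.
Variable R : realType.

Lemma littleo_differentiable (V W : normedModType R) (f : V -> W)
    (df : {linear V -> W}) x : continuous df ->
    (forall e, 0 < e -> \forall h \near (0 : V),
       `|f (h + x) - (f x + df h)| <= e * `|h|) ->
  differentiable f x /\ 'd f x = df :> (V -> W).
Proof.
move=> dfc H.
have E : f \o shift x = cst (f x) + df +o_ 0 id by apply/eqaddoP.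
have D := diff_unique dfc E; split=> //.
by apply/diff_locallyP; rewrite D.
Qed.

Lemma near_eq_differentiable (V W : normedModType R) (f g : V -> W) x :
  (\forall z \near x, f z = g z) -> differentiable f x -> differentiable g x.
Proof.
move=> fg df.
apply: (proj1 (@littleo_differentiable _ _ _ ('d f x) _ _ _)) => [|e e0].
  exact: diff_continuous.
have /diff_locallyP[_ /eqaddoP/(_ _ e0) H] := df.
have fgx : \forall h \near (0 : V), f (h + x) = g (h + x).
  by move: fg; rewrite (near_shift 0)/= subr0.
near=> h.
have <- : f (h + x) = g (h + x) by near: h.
rewrite -(nbhs_singleton fg).
by near: h.
Unshelve. all: by end_near. Qed.

Lemma mulmx_continuous m n (A : 'M[R]_(m, n)) :
  continuous (fun v : 'cV[R]_n => A *m v).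
Proof.
move=> v; apply/(@cvgrPdist_le _ _ _ (nbhs v)) => e e0.
have K0 : 0 < n%:R * `|A| + 1 by rewrite ltr_wpDl// mulr_ge0.
apply: filterS (near_dist_le v (divr_gt0 e0 K0)) => w vw; rewrite -mulmxBr (le_trans (mxnormM _ _))//.
apply: (@le_trans _ _ ((n%:R * `|A| + 1) * `|v - w|)).
  by rewrite ler_wpM2r// lerDl.
by rewrite -ler_pdivlMl// mulrC.
Qed.

(** Carathéodory's criterion: the remainder is [(N z - N w) *m (z - w)], and its first factor tends
    to 0. *)
Lemma slope_differentiable m n (h : 'cV[R]_m -> 'cV[R]_n)
    (N : 'cV[R]_m -> 'M[R]_(n, m)) w :
    (\forall z \near w, h z - h w = N z *m (z - w)) ->
    (forall i j, {for w, continuous (fun z => N z i j)}) ->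
  differentiable h w /\ 'd h w = mulmx (N w) :> ('cV[R]_m -> 'cV[R]_n).
Proof.
move=> hN Nc.
apply: littleo_differentiable => [|e e0]; first exact: mulmx_continuous.
have e'0 : 0 < e / (m%:R + 1) by rewrite divr_gt0// ltr_wpDl.
have H : \forall z \near w, forall i j, `|N w i j - N z i j| <= e / (m%:R + 1).
  apply: (filter_forall (F := nbhs w)) => i.
  apply: (filter_forall (F := nbhs w)) => j.
  by have /(@cvgrPdist_le _ _ _ (nbhs w)) := Nc i j; exact.
have hNx : \forall k \near (0 : 'cV[R]_m), h (k + w) - h w = N (k + w) *m k.
  move: hN; rewrite (near_shift 0)/= subr0.
  by apply: filterS => k /=; rewrite addrK.
have Hx : \forall k \near (0 : 'cV[R]_m), forall i j,
    `|N w i j - N (k + w) i j| <= e / (m%:R + 1).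
  by move: H; rewrite (near_shift 0)/= subr0.
near=> k.
have -> : h (k + w) - (h w + N w *m k) = (N (k + w) - N w) *m k.
  rewrite mulmxBl opprD addrA; congr (_ - _).
  by near: k.
rewrite (le_trans (mxnormM _ _))// ler_wpM2r//.
apply: (@le_trans _ _ (m%:R * (e / (m%:R + 1)))).
  rewrite ler_wpM2l//; apply: mxnorm_le => [|i j]; first exact: ltW.
  by rewrite !mxE distrC; move: i j; near: k.
by rewrite mulrCA ler_piMr ?(ltW e0)// ler_pdivrMr ?mul1r ?lerDl// ltr_wpDl.
Unshelve. all: by end_near. Qed.

End Differentiability.

(** * Smoothness by closure under derivatives *)

Section SmoothAlgebra.
Variables (R : realType) (m : nat) (O : set 'cV[R]_m).
Implicit Types (gen : set ('cV[R]_m -> R)).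

Definition has_derivatives gen (f : 'cV[R]_m -> R) :=
  forall v, exists2 g, algebra_of gen g & forall w, O w -> 'D_v f w = g w.

(** The sum and product rules. Allowing a second set [gen'] lets derivatives lie in a larger algebra
    than the functions themselves. *)
Lemma algebra_of_derivatives gen gen' :
    (forall f, gen f -> [/\ algebra_of gen' f,
      forall w, O w -> differentiable f w & has_derivatives gen' f]) ->
  forall f, algebra_of gen f -> [/\ algebra_of gen' f,
    forall w, O w -> differentiable f w & has_derivatives gen' f].
Proof.
move=> H f; elim=> {f} [f /H//|a|f g _ [af df Df] _ [ag dg Dg]|
                        f g _ [af df Df] _ [ag dg Dg]].
- split=> [|w _|v]; [exact: algebra_of_cst|exact: differentiable_cst|].
  exists (fun=> 0) => [|w _]; [exact: algebra_of_cst|exact: derive_cst].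
- split=> [|w Ow|v]; first exact: algebra_ofD.
    by apply: differentiableD; [exact: df|exact: dg].
  have [f' af' Ef] := Df v; have [g' ag' Eg] := Dg v.
  exists (fun t => f' t + g' t); first exact: algebra_ofD.
  move=> w Ow; rewrite -Ef// -Eg//; apply: deriveD; apply: diff_derivable.
    exact: df.
  exact: dg.
- split=> [|w Ow|v]; first exact: algebra_ofM.
    by apply: differentiableM; [exact: df|exact: dg].
  have [f' af' Ef] := Df v; have [g' ag' Eg] := Dg v.
  exists (fun t => f t * g' t + g t * f' t).
    by apply: algebra_ofD; exact: algebra_ofM.
  move=> w Ow; rewrite -Ef// -Eg//; apply: deriveM; apply: diff_derivable.
    exact: df.
  exact: dg.
Qed.

Lemma differentiable_cV n (F : 'cV[R]_m -> 'cV[R]_n) w :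
  (forall i, differentiable (fun z => F z i 0) w) -> differentiable F w.
Proof.
move=> dF.
have -> : F = \sum_i (fun z => F z i 0 *: (delta_mx i 0 : 'cV[R]_n)).
  apply/funext => z; rewrite fct_sumE; apply/colP => i.
  rewrite summxE (bigD1 i)//= !mxE !eqxx mulr1 big1 ?addr0// => j ji.
  by rewrite !mxE eq_sym (negbTE ji) mulr0.
by apply: differentiable_sum => i; exact: differentiableZl.
Qed.

(** Induction on [k]: the coordinates of a directional derivative lie again in the algebra.
    Membership is asked only up to equality on [O], because the derivatives are known only there. *)
Lemma Ck_algebra gen : open O ->
    (forall f, algebra_of gen f ->
      (forall w, O w -> differentiable f w) /\ has_derivatives gen f) ->
  forall k n (F : 'cV[R]_m -> 'cV[R]_n),
    (forall i, exists2 f, algebra_of gen f & forall w, O w -> F w i 0 = f w) ->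
  Ck k O F.
Proof.
move=> oO H k n; elim: k => [|k IH] F HF.
all: have dF : forall w, O w -> differentiable F w.
1,3: move=> w Ow; apply: differentiable_cV => i; have [f af Ef] := HF i;
     apply: (@near_eq_differentiable _ _ _ f);
     [by near=> z; rewrite Ef//; near: z; exact: open_nbhs_nbhs
     |exact: (H f af).1].
  by move=> w Ow; apply: differentiable_continuous; exact: dF.
split=> // v; apply: IH => i; have [f af Ef] := HF i.
have [_ /(_ v)[g ag Eg]] := H f af.
exists g => // w Ow; rewrite -Eg// derive_mx ?mxE; last first.
  by apply: diff_derivable; exact: dF.
apply: near_eq_derive; near=> z; rewrite Ef//; near: z.
exact: open_nbhs_nbhs.
Unshelve. all: by end_near. Qed.

End SmoothAlgebra.

(** The cube is a product of segments, transposed since [rV_compact] concerns row vectors; the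
    simplex is a closed subset of the cube. *)
Lemma dom_compact (R : realType) d U : compact (@dom R d U).
Proof.
have trc : continuous (fun v : 'rV[R]_d => v^T : 'cV[R]_d).
  move=> v; apply/(@cvgrPdist_le _ _ _ (nbhs v)) => e e0.
  apply: filterS (near_dist_le v e0) => w vw; apply: mxnorm_le => [|i j]; first exact: ltW.
  by rewrite !mxE; have := ler_mxnorm (v - w) j i; rewrite !mxE => /le_trans; apply.
have cube : compact (@dom R d Cube).
  have := @rV_compact _ _ (fun=> `[(0 : R), 1]%classic) (fun _ : 'I_d => segment_compact (a := 0) (b := 1)).
  move=> /(continuous_compact (continuous_subspaceT trc)).
  congr compact; apply/seteqP; split => [_ [v /= H <-] i|x /= H].
    by have := H i; rewrite mxE in_itv.
  exists x^T; last exact: trmxK.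
  by move=> i /=; rewrite mxE in_itv /=; exact: H.
have simplex_closed : closed (@dom R d Simplex).
  have -> : @dom R d Simplex =
    (\bigcap_(i : 'I_d) (fun x : 'cV[R]_d => x i 0) @^-1` [set t | 0 <= t]) `&`
    (fun x : 'cV[R]_d => \sum_i x i 0) @^-1` [set t | t <= 1].
    by apply/seteqP; split => x [x0 x1]; split => // i; [move=> _|]; exact: x0.
  apply: closedI.
    apply: closed_bigI => i _; apply: closed_comp; last exact: closed_ge.
    by move=> x _; exact: coord_continuous.
  apply: closed_comp; last exact: closed_le.
  move=> x _.
  apply: (@algebra_of_continuous _ _ (range (fun i (x : 'cV[R]_d) => x i 0))).
    by move=> _ [i _ <-]; exact: coord_continuous.
  by apply: algebra_of_sum => i; apply: algebra_of_gen; exists i.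
case: U => //; apply: (subclosed_compact simplex_closed cube).
move=> x [x0 x1] i; rewrite x0 /=.
by apply: le_trans x1; rewrite (bigD1 i)//= lerDl sumr_ge0.
Qed.

(** * The inverse map *)

Lemma dist_continuous (R : realType) (V : normedModType R) (a : V) :
  continuous (fun v : V => `|v - a|).
Proof.
move=> v; apply/(@cvgrPdist_le _ _ _ (nbhs v)) => e /near_dist_le.
move=> /(_ _ v); apply: filterS => w; apply: le_trans.
by rewrite (le_trans (ler_dist_dist _ _))// opprB addrA subrK.
Qed.

(** Completeness is what Banach's fixed point theorem requires. *)
HB.instance Definition _ (R : realType) m n := Complete.on 'M[R]_(m, n).

Section LocalInverse.
Variables (R : realType) (d : nat) (U : domain) (p : nat).
Variables (f : mindex d p -> 'cV[R]_d).
Local Notation P := (bezier U f).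
Local Notation M := (slope_mx U f).

Lemma slope_mx_near x0 (e : R) : 0 < e -> exists2 r : R, 0 < r &
  forall x y : 'cV[R]_d, `|x - x0| <= r -> `|y - x0| <= r -> `|M x y - M x0 x0| <= e.
Proof.
move=> e0.
have Mc i j : {for (x0, x0), continuous (fun xy => M xy.1 xy.2 i j)}.
  apply: (@algebra_of_continuous _ _ (range (fun k (xy : 'cV[R]_d * 'cV[R]_d) => xy.1 k 0)
      `|` range (fun k (xy : 'cV[R]_d * 'cV[R]_d) => xy.2 k 0))).
    move=> _ [[k _ <-]|[k _ <-]].
      apply: (@continuous_comp _ _ _ fst (fun x : 'cV[R]_d => x k 0)).
        exact: cvg_fst.
      exact: coord_continuous.
    apply: (@continuous_comp _ _ _ snd (fun x : 'cV[R]_d => x k 0)).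
      exact: cvg_snd.
    exact: coord_continuous.
  apply: algebra_of_slope_mx => k; apply: algebra_of_gen.
    by left; exists k.
  by right; exists k.
have : \forall xy \near (x0, x0), forall i j,
    `|M x0 x0 i j - M xy.1 xy.2 i j| <= e.
  apply: (filter_forall (F := nbhs (x0, x0))) => i.
  apply: (filter_forall (F := nbhs (x0, x0))) => j.
  by have /(@cvgrPdist_le _ _ _ (nbhs (x0, x0))) := Mc i j; exact.
move=> /nbhs_ballP[r /= r0 H]; exists (r / 2); first by rewrite divr_gt0.
have r2 : r / 2 < r by rewrite ltr_pdivrMr// ltr_pMr// ltr1n.
move=> x y xr yr; apply: mxnorm_le => [|i j]; first exact: ltW.
rewrite !mxE -/(M x y i j) distrC.
have := H (x, y); rewrite /= => /(_ _ i j); rewrite !mxE; apply.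
by split; rewrite -ball_normE /= distrC (le_lt_trans _ r2).
Qed.

(** For [v = y - x] the estimated vector is the increment of the Newton map with derivative frozen
    at [x0], which is thus a contraction with factor 1/2. *)
Lemma slope_mx_contraction x0 : M x0 x0 \in unitmx ->
  exists2 r : R, 0 < r & forall x y : 'cV[R]_d, `|x - x0| <= r -> `|y - x0| <= r ->
    M x y \in unitmx /\
    forall v : 'cV[R]_d, `|v - invmx (M x0 x0) *m (M x y *m v)| <= `|v| / 2.
Proof.
set A := invmx _ => M0.
pose K := d%:R * (d%:R * `|A|).
have K0 : 0 <= K by rewrite !mulr_ge0.
have K1 : 0 < K * 2 + 1 by rewrite ltr_wpDl// mulr_ge0.
(* This tolerance, multiplied by [K], is at most 1/2, also when [K = 0]. *)
have [r r0 H] := slope_mx_near x0 (divr_gt0 (@ltr01 R) K1).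
exists r => // x y xr yr; have Me := H x y xr yr.
have small : d%:R * `|1%:M - A *m M x y| <= 1 / 2.
  rewrite -(mulVmx M0) -mulmxBr.
  apply: (@le_trans _ _ (K * `|M x0 x0 - M x y|)).
    by rewrite /K -mulrA ler_wpM2l// mxnormM.
  apply: (@le_trans _ _ (K * (1 / (K * 2 + 1)))).
    by rewrite ler_wpM2l// distrC.
  by rewrite mulrA mulr1 ler_pdivrMr//; lra.
split=> [|v].
  have : A *m M x y \in unitmx.
    apply: unitmx_near1; rewrite distrC (le_lt_trans small)//.
    by rewrite ltr_pdivrMr// mul1r ltr1n.
  by rewrite unitmx_mul => /andP[].
have -> : v - A *m (M x y *m v) = (1%:M - A *m M x y) *m v.
  by rewrite mulmxBl mul1mx mulmxA.
rewrite (le_trans (mxnormM _ _))// mulrC ler_wpM2l//.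
by rewrite (le_trans small)// mul1r.
Qed.

Lemma bezier_local_inverse x0 : M x0 x0 \in unitmx ->
  exists (r e K : R) (h : 'cV[R]_d -> 'cV[R]_d), [/\ 0 < r, 0 < e, 0 <= K,
    forall x y : 'cV[R]_d, `|x - x0| <= r -> `|y - x0| <= r ->
      M x y \in unitmx /\ `|y - x| <= K * `|P y - P x| &
    forall z, `|z - P x0| < e -> `|h z - x0| <= r /\ P (h z) = z].
Proof.
move=> M0; have [r r0 H] := slope_mx_contraction M0.
set A := invmx _ in H.
pose K := d%:R * `|A|; have K0 : 0 <= K by rewrite mulr_ge0.
have K1 : 0 < K * 2 + 1 by rewrite ltr_wpDl// mulr_ge0.
(* The contraction bound gives [|y - x| <= |y - x| / 2 + K * |P y - P x|], whence the constant
   [K * 2]. *)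
have inj (x y : 'cV[R]_d) : `|x - x0| <= r -> `|y - x0| <= r ->
    M x y \in unitmx /\ `|y - x| <= K * 2 * `|P y - P x|.
  move=> xr yr; have [Mu Hv] := H x y xr yr; split=> //.
  have := Hv (y - x); rewrite -bezierB => le1.
  have le2 : `|A *m (P y - P x)| <= K * `|P y - P x| by exact: mxnormM.
  have := ler_normD (y - x - A *m (P y - P x)) (A *m (P y - P x)).
  by rewrite subrK; lra.
have B0 : [set x : 'cV[R]_d | `|x - x0| <= r] x0 by rewrite /= subrr normr0 ltW.
have cB : closed [set x : 'cV[R]_d | `|x - x0| <= r].
  apply: (@closed_comp _ _ (fun x : 'cV[R]_d => `|x - x0|) [set t | t <= r]).
    by move=> x _; exact: dist_continuous.
  exact: closed_le.
have solve z : `|z - P x0| < r / (K * 2 + 1) ->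
    exists x, `|x - x0| <= r /\ P x = z.
  move=> ze; pose phi x := x - A *m (P x - z).
  have phiB x y : phi y - phi x = (y - x) - A *m (M x y *m (y - x)).
    rewrite -bezierB /phi opprD !opprK addrACA; congr (_ + _).
    by rewrite addrC -mulmxBr -opprB -mulmxN; congr (_ *m _); rewrite !opprB addrA subrK.
  have phi_r : {homo phi : x / [set x : 'cV[R]_d | `|x - x0| <= r] x}.
    move=> x /= xr; rewrite -(subrKA (phi x0)).
    rewrite (le_trans (ler_normD _ _))// phiB.
    have le1 := (H x0 x (B0) xr).2 (x - x0).
    (* The radius [r / (K * 2 + 1)] for [z] is chosen for this bound; the contraction contributes
       the other [r / 2], so [phi] preserves the ball. *)
    have le2 : `|phi x0 - x0| <= r / 2.
      rewrite /phi addrAC subrr add0r normrN.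
      rewrite (le_trans (mxnormM _ _))// -/K distrC.
      apply: (@le_trans _ _ (K * (r / (K * 2 + 1)))).
        by rewrite ler_wpM2l// ltW.
      rewrite mulrA ler_pdivrMr//; nra.
    by rewrite /= in xr; lra.
  pose g := mkfun phi_r.
  have [x Bx xE] : exists2 x, [set x : 'cV[R]_d | `|x - x0| <= r] x & x = g x.
    apply: (@banach_fixed_point _ _ _ g) => //; last by exists x0.
    have q0 : (0 : R) <= 1 / 2 by rewrite divr_ge0.
    exists (NngNum q0); split => /=; first by rewrite ltr_pdivrMr// mul1r ltr1n.
    move=> [y x] [/= yr xr]; rewrite phiB.
    by have := (H x y xr yr).2 (y - x); lra.
  exists x; split=> //.
  have : A *m (P x - z) = 0.
    by move/eqP: xE; rewrite /g /= /phi eq_sym -subr_eq0 addrAC subrr add0r oppr_eq0 => /eqP.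
  move=> /(congr1 (mulmx (M x0 x0))); rewrite mulmxA mulmxV// mul1mx mulmx0.
  by move/eqP; rewrite subr_eq0 => /eqP.
exists r, (r / (K * 2 + 1)), (K * 2).
(* A choice of solutions, with default value [x0] where there is none. *)
exists (fun z => xget x0 [set x : 'cV[R]_d | `|x - x0| <= r /\ P x = z]).
split=> //; [by rewrite divr_gt0|by rewrite mulr_ge0|].
by move=> z /solve ex; exact: (xgetPex x0 ex).
Qed.

End LocalInverse.

(** * Smoothness of local inverses and global invertibility *)

Section SmoothInverse.
Variables (R : realType) (d : nat) (U : domain) (p : nat).
Variables (f : mindex d p -> 'cV[R]_d).
Local Notation P := (bezier U f).
Local Notation M := (slope_mx U f).

Section RightInverse.
Variables (O : set 'cV[R]_d) (h : 'cV[R]_d -> 'cV[R]_d) (K : R).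
Hypothesis O_open : open O.
Hypothesis hK : forall z, O z -> P (h z) = z.
Hypothesis h_lipschitz : forall w z, O w -> O z -> `|h z - h w| <= K * `|z - w|.
Hypothesis h_unit : forall w z, O w -> O z -> M (h w) (h z) \in unitmx.
Hypothesis K0 : 0 <= K.

Let coords : set ('cV[R]_d -> R) := range (fun k z => h z k 0).
Let invdet z := (\det (M (h z) (h z)))^-1.
(** By Cramer's rule the entries of the derivative of [h] are [invdet] times cofactors, and these
    are polynomials in [coords]. *)
Let gens := coords `|` [set invdet].

Let h_continuous w : O w -> {for w, continuous h}.
Proof.
move=> Ow; apply/(@cvgrPdist_le _ _ _ (nbhs w)) => e e0.
have K1 : 0 < K + 1 by rewrite ltr_wpDl.
have : \forall z \near w, O z by exact: open_nbhs_nbhs.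
apply: filterS2 (near_dist_le w (divr_gt0 e0 K1)) => z wz Oz.
rewrite (le_trans (h_lipschitz Oz Ow))//.
apply: (@le_trans _ _ ((K + 1) * `|w - z|)); first by rewrite ler_wpM2r// lerDl.
by rewrite -ler_pdivlMl// mulrC.
Qed.

Let coords_continuous w : O w -> forall g, algebra_of coords g -> {for w, continuous g}.
Proof.
move=> Ow; apply: algebra_of_continuous => _ [k _ <-].
apply: (@continuous_comp _ _ _ h (fun y : 'cV[R]_d => y k 0)).
  exact: h_continuous.
exact: coord_continuous.
Qed.

(** Cramer's formula for the inverse of [M (h w) (h z)] turns [bezierB] into the hypothesis of
    [slope_differentiable]; it is continuous in [z] at [w] because [h] is. *)
Let h_diff w : O w -> differentiable h w /\
  'd h w = mulmx (invdet w *: \adj (M (h w) (h w))) :> ('cV[R]_d -> 'cV[R]_d).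
Proof.
move=> Ow.
pose N z := (\det (M (h w) (h z)))^-1 *: \adj (M (h w) (h z)).
apply: (@slope_differentiable _ _ _ _ N) => [|i j].
  have : \forall z \near w, O z by exact: open_nbhs_nbhs.
  apply: filterS => z Oz.
  have -> : z - w = P (h z) - P (h w) by rewrite !hK.
  rewrite bezierB mulmxA /N -scalemxAl mul_adj_mx -scalemxAl mul_scalar_mx scalerA mulVr ?scale1r//.
  by rewrite -unitmxE h_unit.
have Malg k l : algebra_of coords (fun z => M (h w) (h z) k l).
  apply: algebra_of_slope_mx => m; first exact: algebra_of_cst.
  by apply: algebra_of_gen; exists m.
have -> : (fun z => N z i j) = (fun z =>
    (\det (M (h w) (h z)))^-1 * (\adj (M (h w) (h z))) i j).
  by apply/funext => z; rewrite /N mxE.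
apply: continuousM; last exact: coords_continuous (algebra_of_adj _ _ _).
apply: continuousV; last exact: coords_continuous (algebra_of_det _).
by rewrite -unitfE -unitmxE h_unit.
Qed.

Let coords_derivatives g : coords g -> [/\ algebra_of gens g,
  forall w, O w -> differentiable g w & has_derivatives O gens g].
Proof.
move=> [k _ <-].
have dk w : O w -> differentiable (fun z => h z k 0) w.
  move=> /h_diff[dh _].
  apply: (@differentiable_comp _ _ _ _ h (fun y : 'cV[R]_d => y k 0)) => //.
  exact: differentiable_coord.
split=> // [|v]; first by apply: algebra_of_gen; left; exists k.
exists (fun w => \sum_j invdet w * (\adj (M (h w) (h w))) k j * v j 0).
  apply: algebra_of_sum => j; apply: algebra_ofM; last exact: algebra_of_cst.
  apply: algebra_ofM; first by apply: algebra_of_gen; right.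
  apply: algebra_of_adj => i l.
  by apply: algebra_of_slope_mx => m; apply: algebra_of_gen; left; exists m.
move=> w Ow; have [dh hE] := h_diff Ow.
have -> : 'D_v (fun z => h z k 0) w = ('D_v h w) k 0.
  by rewrite derive_mx ?mxE//; exact: diff_derivable.
rewrite deriveE// hE mxE; apply: eq_bigr => j _.
by rewrite [X in X * _]mxE.
Qed.

Let gens_derivatives g : algebra_of gens g ->
  (forall w, O w -> differentiable g w) /\ has_derivatives O gens g.
Proof.
suff H a : gens a -> [/\ algebra_of gens a,
    forall w, O w -> differentiable a w & has_derivatives O gens a].
  by move=> /(algebra_of_derivatives H)[].
move=> [/coords_derivatives//|->].
(* The determinant lies in the algebra of [coords] alone, so its derivatives are already known to
   lie in that of [gens]; the rule for reciprocals then handles [invdet]. *)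
have [_ dD DD] : [/\ algebra_of gens (fun z => \det (M (h z) (h z))),
    forall w, O w -> differentiable (fun z => \det (M (h z) (h z))) w &
    has_derivatives O gens (fun z => \det (M (h z) (h z)))].
  apply: (algebra_of_derivatives coords_derivatives).
  apply: algebra_of_det => i l.
  by apply: algebra_of_slope_mx => m; apply: algebra_of_gen; exists m.
have D0 w : O w -> \det (M (h w) (h w)) != 0.
  by move=> Ow; rewrite -unitfE -unitmxE h_unit.
have ginv : algebra_of gens invdet by apply: algebra_of_gen; right.
split=> // [w Ow|v]; first by apply: differentiableV; [exact: dD|exact: D0].
have [g' ag' gE] := DD v.
exists (fun w => -1 * (invdet w * invdet w) * g' w).
  apply: algebra_ofM => //; apply: algebra_ofM; first exact: algebra_of_cst.
  exact: algebra_ofM.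
move=> w Ow; rewrite /invdet deriveV ?D0//; last exact/diff_derivable/dD.
by rewrite gE// mulN1r -invfM -expr2.
Qed.

Lemma right_inverse_smooth k : Ck k O h.
Proof.
apply: (Ck_algebra O_open gens_derivatives) => i.
by exists (fun z => h z i 0) => //; apply: algebra_of_gen; left; exists i.
Qed.

End RightInverse.

Lemma bezier_continuous : continuous P.
Proof.
move=> x; apply: differentiable_continuous; apply: differentiable_cV => i.
pose gen : set ('cV[R]_d -> R) := range (fun k (v : 'cV[R]_d) => v k 0).
have H : forall g, algebra_of gen g -> differentiable g x.
  move=> g; elim=> {g} [_ [k _ <-]|a|g g' _ dg _ dg'|g g' _ dg _ dg'].
  - exact: differentiable_coord.
  - exact: differentiable_cst.
  - exact: differentiableD.
  - exact: differentiableM.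
apply: H; apply: (algebra_of_expect _ (x := id) (g := fun=> net f)) => [k|c k].
  by apply: algebra_of_gen; exists k.
exact: algebra_of_cst.
Qed.

Lemma bezier_invertible :
    (forall x y, dom U x -> dom U y -> M x y \in unitmx) ->
  invertible_on (dom U) P.
Proof.
move=> Mu.
have Pinj x y : dom U x -> dom U y -> P x = P y -> x = y.
  move=> Ux Uy Pxy; have := bezierB U f x y; rewrite Pxy subrr.
  move=> /(congr1 (mulmx (invmx (M x y)))); rewrite mulmxA mulVmx ?Mu//.
  by rewrite mulmx0 mul1mx => /esym/eqP; rewrite subr_eq0 => /eqP.
split; first by move=> x y; rewrite !inE; exact: Pinj.
have GP x : dom U x -> xget 0 [set x' | dom U x' /\ P x' = P x] = x.
  move=> Ux; have [] : [set x' | dom U x' /\ P x' = P x]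
      (xget 0 [set x' | dom U x' /\ P x' = P x]) by apply: xgetPex; exists x.
  by move=> UG /Pinj; apply.
exists (fun z => xget 0 [set x' | dom U x' /\ P x' = z]) => //.
move=> _ [x0 Ux0 <-].
have [r [e [K [h [r0 e0 K0 inj hP]]]]] := bezier_local_inverse (Mu _ _ Ux0 Ux0).
(* On the compact set of points of [U] at distance at least [r] from [x0], the distance of [P x] to
   [P x0] has a minimum, which is positive by injectivity. *)
have [e' e'0 far] : exists2 e' : R, 0 < e' &
    forall x, dom U x -> `|P x - P x0| < e' -> `|x - x0| <= r.
  pose Q := dom U `&` [set x : 'cV[R]_d | r <= `|x - x0|].
  have Qc : compact Q.
    apply: compact_closedI; first exact: dom_compact.
    apply: (@closed_comp _ _ (fun x : 'cV[R]_d => `|x - x0|) [set t | r <= t]).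
      by move=> x _; exact: dist_continuous.
    exact: closed_ge.
  have [Q0|/set0P Qn0] := eqVneq Q set0.
    exists 1 => // x Ux _; rewrite leNgt; apply/negP => /ltW rx.
    by have : Q x by []; rewrite Q0.
  have cdist : continuous (fun x => `|P x - P x0|).
    move=> x; apply: (@continuous_comp _ _ _ P (fun y => `|y - P x0|)).
      exact: bezier_continuous.
    exact: dist_continuous.
  have [c] := compact_EVT_min Qn0 Qc (continuous_subspaceT cdist).
  rewrite inE => -[Uc rc] cmin; exists `|P c - P x0|.
    rewrite normr_gt0 subr_eq0; apply/eqP => /(Pinj _ _ Uc Ux0) E.
    by move: rc; rewrite /= E subrr normr0 leNgt r0.
  move=> x Ux; rewrite ltNge => xc; rewrite leNgt; apply: contra xc => /ltW rx.
  by apply: cmin; rewrite inE.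
have e2 : 0 < Num.min e e' by rewrite lt_min e0.
have OP z : ball (P x0) (Num.min e e') z ->
    `|z - P x0| < e /\ `|z - P x0| < e'.
  by rewrite -ball_normE /= distrC lt_min => /andP[].
exists (ball (P x0) (Num.min e e')), h; split.
- exact: ball_open.
- exact: ballxx.
(* Values of [h] may lie outside [U], so invertibility of the slope matrix is taken from the ball
   around [x0] and not from [Mu]. *)
- move=> k; apply: (@right_inverse_smooth _ _ K) => //.
  + exact: ball_open.
  + by move=> z /OP[ze _]; exact: (hP z ze).2.
  + move=> w z /OP[/hP[wr wE] _] /OP[/hP[zr zE] _].
    by rewrite -{2}wE -{2}zE; exact: (inj _ _ wr zr).2.
  + move=> w z /OP[/hP[wr _] _] /OP[/hP[zr _] _].
    exact: (inj _ _ wr zr).1.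
move=> _ [x Ux <-] /OP[xe xe']; rewrite GP//.
(* Both [h (P x)] and [x] lie in the ball on which [inj] makes [P] injective, so they coincide. *)
have [hr hE] := hP _ xe; have xr := far _ Ux xe'.
apply/eqP; rewrite -subr_eq0 -normr_le0.
by have := (inj _ _ xr hr).2; rewrite hE subrr normr0 mulr0.
Qed.

End SmoothInverse.

Lemma eq_invertible_on (R : realType) d (U : set 'cV[R]_d) (F P : 'cV[R]_d -> 'cV[R]_d) :
  (forall x, U x -> F x = P x) -> invertible_on U P -> invertible_on U F.
Proof.
move=> FP [Pinj [G GP Gs]]; split.
  by move=> x y; rewrite !inE => Ux Uy; rewrite !FP//; apply: Pinj; rewrite inE.
exists G; first by move=> x Ux; rewrite FP// GP.
by have -> : F @` U = P @` U by exact: eq_imagel.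
Qed.

Local Close Scope ring_scope.
Local Close Scope classical_set_scope.

(* For p = 0 the lists of control points of the derivatives are empty and the
   hull condition holds vacuously for every constant map, whence 0 < p in the
   sufficiency part. *)
Theorem mainTheorem5 (R : realType) (d : nat) (hd : d = 2 \/ d = 3)
    (U : domain) (p : nat) :
  ((0 < p)%N ->
    forall F : 'cV[R]_d -> 'cV[R]_d,
      poly_map U p F -> hull_condition U p F -> invertible_on (dom U) F) /\
  affinity_property U p (@hull_condition R d U p).
Proof.
split; last by apply: hull_condition_affinity; case: hd => ->.
move=> p0 F _ [f /control_bezier Ff Hf].
apply: (eq_invertible_on Ff); apply: bezier_invertible => x y Ux Uy.
by apply: Hf => k; exact: slope_hull.
Qed.
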